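(* Let $M$ be a $C^2$ submanifold of $\mathbb{R}^d$. For every $x\in\mathcal{E}(M)\setminus M$ the derivative of the projection $p$ in $x$ is given by $$Dp(x)=\Big(\mathrm{id}_{T_{p(x)}(M)}-\|x-p(x)\|\,L_{p(x),v}\Big)^{-1}P_{T_{p(x)}(M)},$$ where $v=\|x-p(x)\|^{-1}(x-p(x))$ and $L_{p(x),v}$ is the shape operator in direction $v$ at $p(x)$. For every $x\in M$ the derivative of $p$ in $x$ is $Dp(x)=P_{T_{p(x)}(M)}$.
   Context: Submanifolds are nonempty. Let $0\le m<d$. A set $M\subseteq\mathbb{R}^d$ is an $m$-dimensional $C^k$ submanifold of $\mathbb{R}^d$ if for every $\xi\in M$ there are open sets $U,V\subseteq\mathbb{R}^d$ with $\xi\in U$ and a $C^k$ diffeomorphism $\Psi:V\to U$ such that for all $y\in V$: $\Psi(y)\in M\iff y_{m+1}=\dots=y_d=0$. The case $m=d$ is excluded throughout. $T_\xi(M)$ denotes the tangent space (a linear subspace of $\mathbb{R}^d$), and $P_{T_\xi(M)}:\mathbb{R}^d\to T_\xi(M)$ the orthogonal projection onto it. $d(x,M)=\inf_{\xi\in M}\|x-\xi\|$ (Euclidean norm). $\operatorname{unpp}(M)$ is the set of $x\in\mathbb{R}^d$ for which there is exactly one $\xi\in M$ with $\|x-\xi\|=d(x,M)$; this $\xi$ is denoted $p(x)$. $\mathcal{E}(M)$ is the interior of $\operatorname{unpp}(M)$, and $p$ is considered on $\mathcal{E}(M)$. Shape operator: let $\xi\in M$ and let $v$ be a unit vector orthogonal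 to $T_\xi(M)$. Choose a relatively open $V\subseteq M$ with $\xi\in V$ and a $C^1$ map $n:V\to\mathbb{R}^d$ with $\|n(\eta)\|=1$ and $n(\eta)\perp T_\eta(M)$ for all $\eta\in V$ and $n(\xi)=v$. Then $L_{\xi,v}:T_\xi(M)\to T_\xi(M)$, $L_{\xi,v}:=-P_{T_\xi(M)}Dn(\xi)$, where $Dn(\xi):T_\xi(M)\to\mathbb{R}^d$ is the derivative of $n$ along $M$. (Such $n$ exists and $L_{\xi,v}$ does not depend on its choice.) *)

(* Defs.v *)
(* MathComp-Analysis.  R^d is 'rV[R]_d; its topology and Fréchet derivative come
   from the library's sup norm, which is equivalent to the Euclidean norm
   [enorm].  Metric notions (distance, nearest points, orthogonality, unit
   vectors) all use [dot] and [enorm]. *)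
From HB Require Import structures.
From mathcomp Require Import all_boot all_order all_algebra.
From mathcomp Require Import all_classical all_reals all_analysis.
Set Implicit Arguments.
Unset Strict Implicit.
Unset Printing Implicit Defensive.
Import Order.TTheory GRing.Theory Num.Theory.
Import numFieldNormedType.Exports.
Local Open Scope classical_set_scope.
Local Open Scope ring_scope.

Definition dot {R : realType} {d : nat} (x y : 'rV[R]_d) : R :=
  \sum_(i < d) x 0 i * y 0 i.

Definition enorm {R : realType} {d : nat} (x : 'rV[R]_d) : R :=
  Num.sqrt (dot x x).

Definition dist_set {R : realType} {d : nat} (x : 'rV[R]_d) (M : set 'rV[R]_d) : R :=
  inf [set enorm (x - xi) | xi in M].

(* [Ck k U f]: f is of class C^k on the open set U.  In the recursive step,
   [Df] is C^k as a map into linear maps iff [x |-> Df(x) v] is C^k for every v;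
   this equivalence needs V finite-dimensional, and below V is 'rV_d or R. *)
Fixpoint Ck {R : realType} {V W : normedModType R} (k : nat)
    (U : set V) (f : V -> W) : Prop :=
  match k with
  | 0 => forall x, U x -> {for x, continuous f}
  | k'.+1 => (forall x, U x -> differentiable f x) /\
             (forall v : V, Ck k' U (fun x => 'd f x v))
  end.

Definition Ck_diffeo {R : realType} {d : nat} (k : nat)
    (V U : set 'rV[R]_d) (Psi : 'rV[R]_d -> 'rV[R]_d) : Prop :=
  exists Phi : 'rV[R]_d -> 'rV[R]_d,
    [/\ forall y, V y -> U (Psi y) /\ Phi (Psi y) = y,
        forall z, U z -> V (Phi z) /\ Psi (Phi z) = z,
        Ck k V Psi & Ck k U Phi].

(* Coordinates are numbered from 0, so y_{m+1} = ... = y_d = 0 concerns the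
   indices i with m <= i. *)
Definition submanifold {R : realType} {d : nat} (k m : nat)
    (M : set 'rV[R]_d) : Prop :=
  M !=set0 /\
  forall xi, M xi -> exists (U V : set 'rV[R]_d) (Psi : 'rV[R]_d -> 'rV[R]_d),
    [/\ open U, open V, U xi, Ck_diffeo k V U Psi &
        forall y, V y ->
          (M (Psi y) <-> forall i : 'I_d, (m <= i)%N -> y 0 i = 0)].

(* A C^1 curve ]-e, e[ -> M passing through xi at time 0 with velocity w. *)
Definition curve_through {R : realType} {d : nat} (M : set 'rV[R]_d)
    (xi w : 'rV[R]_d) (c : R -> 'rV[R]_d) : Prop :=
  [/\ exists2 e : R, 0 < e &
        Ck 1 `]-e, e[%classic c /\ (forall t, `]-e, e[%classic t -> M (c t)),
      c 0 = xi & is_derive (0 : R) (1 : R) c w].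

Definition tangent {R : realType} {d : nat} (M : set 'rV[R]_d)
    (xi : 'rV[R]_d) : set 'rV[R]_d :=
  [set w | exists c, curve_through M xi w c].

(* The orthogonal projection onto a linear subspace T. *)
Definition orthoproj {R : realType} {d : nat} (T : set 'rV[R]_d)
    (x : 'rV[R]_d) : 'rV[R]_d :=
  xget 0 [set y | T y /\ forall z, T z -> dot (x - y) z = 0].

Definition nearest_points {R : realType} {d : nat} (M : set 'rV[R]_d)
    (x : 'rV[R]_d) : set 'rV[R]_d :=
  [set xi | M xi /\ enorm (x - xi) = dist_set x M].

Definition unpp {R : realType} {d : nat} (M : set 'rV[R]_d) : set 'rV[R]_d :=
  [set x | exists! xi, nearest_points M x xi].

Definition unpp_int {R : realType} {d : nat} (M : set 'rV[R]_d) :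
  set 'rV[R]_d := (unpp M)°.

(* The nearest-point map p; meaningful on [unpp M] only. *)
Definition closest_point {R : realType} {d : nat} (M : set 'rV[R]_d)
    (x : 'rV[R]_d) : 'rV[R]_d :=
  xget 0 (nearest_points M x).

(* A map on a subset A of R^d is C^1 if near each point of A it is the
   restriction of a C^1 map on an open subset of R^d. *)
Definition C1_on_subset {R : realType} {d : nat} (A : set 'rV[R]_d)
    (f : 'rV[R]_d -> 'rV[R]_d) : Prop :=
  forall xi, A xi -> exists (O : set 'rV[R]_d) (F : 'rV[R]_d -> 'rV[R]_d),
    [/\ open O, O xi, Ck 1 O F & forall eta, (A `&` O) eta -> F eta = f eta].

(* Df(xi) w for w tangent to M at xi: the velocity of f o c for a C^1 curve c
   in M through xi with velocity w.  For f that is C^1 near xi in M it does not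
   depend on c.  The value is 0 (default) when w is not tangent. *)
Definition deriv_along {R : realType} {d : nat} (M : set 'rV[R]_d)
    (f : 'rV[R]_d -> 'rV[R]_d) (xi w : 'rV[R]_d) : 'rV[R]_d :=
  xget 0 [set u | exists c, curve_through M xi w c /\
                            is_derive (0 : R) (1 : R) (f \o c) u].

(* n is a C^1 unit normal field, with n xi = v, on the relatively open subset V
   of M containing xi. *)
Definition unit_normal_field {R : realType} {d : nat} (M V : set 'rV[R]_d)
    (xi v : 'rV[R]_d) (n : 'rV[R]_d -> 'rV[R]_d) : Prop :=
  [/\ exists2 O : set 'rV[R]_d, open O & V = M `&` O,
      V xi,
      C1_on_subset V n,
      forall eta, V eta ->
        enorm (n eta) = 1 /\ (forall w, tangent M eta w -> dot (n eta) w = 0) &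
      n xi = v].

(* The shape operator L_{xi,v}, as a function on R^d of which only the values on
   [tangent M xi] are meaningful. *)
Definition shape_operator {R : realType} {d : nat} (M : set 'rV[R]_d)
    (xi v : 'rV[R]_d) : 'rV[R]_d -> 'rV[R]_d :=
  xget (fun=> 0) [set L | exists V n, unit_normal_field M V xi v n /\
    L = fun w => - orthoproj (tangent M xi) (deriv_along M n xi w)].

(* Main.v *)
(* Let x be interior to [unpp M], with nearest point xi. A second nearest point z
   in the closure of M would be the only candidate for a nearest point of
   x + t (z - x); hence the projection p is continuous on [unpp_int M] even when M
   is not closed. By continuity the distance to M grows at unit rate in the
   direction x - p(x), so xi is still nearest to a point of the normal ray beyond
   x. Comparing the two balls gives |x - eta|^2 >= |x - xi|^2 + k |eta - xi|^2 on M
   for some k > 0, that is, id - r L is positive definite.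
   In a chart Psi, the continuous map p solves the C^1 equation
   "x - p(x) is normal to M", whose derivative along M is this positive definite
   form, so p can be differentiated implicitly.
   A point of M has a neighbourhood in [unpp M] because normal vectors are
   orthogonal to secants up to an error quadratic in the secant. *)
Require Import Defs.
From HB Require Import structures.
From mathcomp Require Import all_boot all_order all_algebra.
From mathcomp Require Import all_classical all_reals all_analysis.
From mathcomp Require Import ring lra.
Import Order.TTheory GRing.Theory Num.Theory.
Import numFieldNormedType.Exports.
Set Implicit Arguments.
Unset Strict Implicit.
Unset Printing Implicit Defensive.
Local Open Scope classical_set_scope.
Local Open Scope ring_scope.

(** * Euclidean norm *)

(** That [xi] is nearest to [x] only makes [id - r L] positive semidefinite; it degenerates at focal
    points. Interiority of [x] in [unpp M] has to exclude these, with no tubular neighbourhood given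
    in advance. The unit growth of the distance is infinitesimal, in a direction that turns with the
    base point, so it is not integrated along the ray. Instead, a point that maximises the distance
    over the ball of radius [e] about [x] is shown to be at distance at least [r + e] from [M], and
    the triangle inequality leaves it only one place: on the ray. Since [p] is already continuous, a
    first-order expansion of the critical-point equation at [(x, Phi (p x))] alone suffices to
    differentiate it. The unknown stays in R^d: the equations [y_i = 0], [m <= i], complete the [m]
    normal equations to a square system, so that everything reduces to one invertible matrix. *)

Lemma dotC {R : realType} {d : nat} (x y : 'rV[R]_d) : dot x y = dot y x.
Proof. by apply: eq_bigr => i _; rewrite mulrC. Qed.

Lemma dot_linearP {R : realType} {d : nat} (x : 'rV[R]_d) : linear (dot x).
Proof.
move=> a y z; transitivity (a * dot x y + dot x z) => //.
rewrite /dot mulr_sumr -big_split /=.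
by apply: eq_bigr => i _; rewrite !mxE; ring.
Qed.

HB.instance Definition _ {R : realType} {d : nat} (x : 'rV[R]_d) :=
  GRing.isLinear.Build R 'rV[R]_d R *:%R (dot x) (dot_linearP x).

Lemma dotDr {R : realType} {d : nat} (x y z : 'rV[R]_d) :
  dot x (y + z) = dot x y + dot x z.
Proof. exact: raddfD. Qed.

Lemma dotNr {R : realType} {d : nat} (x y : 'rV[R]_d) : dot x (- y) = - dot x y.
Proof. exact: raddfN. Qed.

Lemma dotBr {R : realType} {d : nat} (x y z : 'rV[R]_d) :
  dot x (y - z) = dot x y - dot x z.
Proof. exact: raddfB. Qed.

Lemma dotZr {R : realType} {d : nat} a (x y : 'rV[R]_d) :
  dot x (a *: y) = a * dot x y.
Proof. exact: linearZ. Qed.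

Lemma dot0r {R : realType} {d : nat} (x : 'rV[R]_d) : dot x 0 = 0.
Proof. exact: raddf0. Qed.

Lemma dotDl {R : realType} {d : nat} (x y z : 'rV[R]_d) :
  dot (y + z) x = dot y x + dot z x.
Proof. by rewrite dotC dotDr !(dotC x). Qed.

Lemma dotNl {R : realType} {d : nat} (x y : 'rV[R]_d) : dot (- y) x = - dot y x.
Proof. by rewrite dotC dotNr (dotC x). Qed.

Lemma dotBl {R : realType} {d : nat} (x y z : 'rV[R]_d) :
  dot (y - z) x = dot y x - dot z x.
Proof. by rewrite dotDl dotNl. Qed.

Lemma dotZl {R : realType} {d : nat} a (x y : 'rV[R]_d) :
  dot (a *: y) x = a * dot y x.
Proof. by rewrite dotC dotZr (dotC x). Qed.

Lemma dot0l {R : realType} {d : nat} (x : 'rV[R]_d) : dot 0 x = 0.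
Proof. by rewrite dotC dot0r. Qed.

Definition dotE := (@dotDl, @dotDr, @dotNl, @dotNr, @dotZl, @dotZr, @dot0l, @dot0r).

Lemma dot_ge0 {R : realType} {d : nat} (x : 'rV[R]_d) : 0 <= dot x x.
Proof. by apply: sumr_ge0 => i _; rewrite -expr2 sqr_ge0. Qed.

Lemma dot_eq0 {R : realType} {d : nat} (x : 'rV[R]_d) : (dot x x == 0) = (x == 0).
Proof.
apply/eqP/eqP => [/eqP|->]; last by rewrite dot0r.
rewrite psumr_eq0 => [/allP x0|i _]; last by rewrite -expr2 sqr_ge0.
apply/rowP => i; rewrite mxE; apply/eqP; have := x0 i (mem_index_enum i).
by rewrite mulf_eq0 orbb.
Qed.

Lemma dot_delta {R : realType} {d : nat} (x : 'rV[R]_d) i :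
  dot x (delta_mx 0 i) = x 0 i.
Proof.
rewrite /dot (bigD1 i)//= mxE !eqxx mulr1 big1 ?addr0// => j ji.
by rewrite mxE (negbTE ji) andbF mulr0.
Qed.

Lemma enorm_ge0 {R : realType} {d : nat} (x : 'rV[R]_d) : 0 <= enorm x.
Proof. exact: sqrtr_ge0. Qed.

Lemma sqr_enorm {R : realType} {d : nat} (x : 'rV[R]_d) : enorm x ^+ 2 = dot x x.
Proof. by rewrite sqr_sqrtr// dot_ge0. Qed.

Lemma enorm_eq0 {R : realType} {d : nat} (x : 'rV[R]_d) : (enorm x == 0) = (x == 0).
Proof. by rewrite -dot_eq0 -sqr_enorm sqrf_eq0. Qed.

Lemma enorm0 {R : realType} {d : nat} : enorm (0 : 'rV[R]_d) = 0.
Proof. by apply/eqP; rewrite enorm_eq0. Qed.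

Lemma enormN {R : realType} {d : nat} (x : 'rV[R]_d) : enorm (- x) = enorm x.
Proof. by rewrite /enorm dotNl dotNr opprK. Qed.

Lemma enormC {R : realType} {d : nat} (x y : 'rV[R]_d) : enorm (x - y) = enorm (y - x).
Proof. by rewrite -enormN opprB. Qed.

Lemma enormZ {R : realType} {d : nat} a (x : 'rV[R]_d) :
  enorm (a *: x) = `|a| * enorm x.
Proof. by rewrite /enorm !dotE mulrA -expr2 sqrtrM ?sqr_ge0// sqrtr_sqr. Qed.

Lemma enorm_le {R : realType} {d : nat} (x y : 'rV[R]_d) :
  (enorm x <= enorm y) = (dot x x <= dot y y).
Proof. by rewrite /enorm ler_sqrt// dot_ge0. Qed.

Lemma cauchy_schwarz {R : realType} {d : nat} (x y : 'rV[R]_d) :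
  dot x y <= enorm x * enorm y.
Proof.
have [x0|x0] := eqVneq (enorm x) 0.
  by rewrite x0 mul0r; move/eqP: x0; rewrite enorm_eq0 => /eqP ->; rewrite dot0l.
have [y0|y0] := eqVneq (enorm y) 0.
  by rewrite y0 mulr0; move/eqP: y0; rewrite enorm_eq0 => /eqP ->; rewrite dot0r.
have xy0 : 0 < enorm x * enorm y.
  by rewrite mulr_gt0// lt_neqAle eq_sym ?x0 ?y0 enorm_ge0.
have := dot_ge0 (enorm y *: x - enorm x *: y).
rewrite !dotE -!sqr_enorm (dotC y x) => h; rewrite -(ler_pM2l xy0).
have -> : enorm x * enorm y * (enorm x * enorm y) = enorm x ^+ 2 * enorm y ^+ 2 by ring.
lra.
Qed.

Lemma ler_enormD {R : realType} {d : nat} (x y : 'rV[R]_d) :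
  enorm (x + y) <= enorm x + enorm y.
Proof.
have xy0 : 0 <= enorm x + enorm y by rewrite addr_ge0 ?enorm_ge0.
rewrite -(@ler_pXn2r _ 2)// ?nnegrE ?enorm_ge0//.
rewrite sqr_enorm !dotE sqrrD !sqr_enorm (dotC y x).
have := cauchy_schwarz x y; lra.
Qed.

Lemma ler_enormB {R : realType} {d : nat} (x y z : 'rV[R]_d) :
  enorm (x - z) <= enorm (x - y) + enorm (y - z).
Proof. by rewrite (le_trans _ (ler_enormD _ _))// subrKA. Qed.

Lemma ler_coord {R : realType} {m n : nat} (x : 'M[R]_(m, n)) i j :
  `|x i j| <= `|x|.
Proof.
rewrite [leRHS]/Num.Def.normr /= mx_normrE.
exact: (le_bigmax _ (fun ij : 'I_m * 'I_n => `|x ij.1 ij.2|) (i, j)).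
Qed.

Lemma ler_rV_norm {R : realType} {d : nat} (x : 'rV[R]_d) (e : R) : 0 <= e ->
  (forall i, `|x 0 i| <= e) -> `|x| <= e.
Proof.
move=> e0 xe; rewrite [leLHS]/Num.Def.normr /= mx_normrE; apply/bigmax_leP; split=> //.
by case=> i j _ /=; rewrite ord1.
Qed.

Lemma ler_norm_enorm {R : realType} {d : nat} (x : 'rV[R]_d) : `|x| <= enorm x.
Proof.
apply: ler_rV_norm => [|i]; first exact: enorm_ge0.
rewrite -sqrtr_sqr /enorm ler_sqrt ?dot_ge0// /dot (bigD1 i)//= expr2 lerDl.
by apply: sumr_ge0 => j _; rewrite -expr2 sqr_ge0.
Qed.

(** The sharp constant is the square root of [d]; comparing the two topologies only takes some
    constant. *)
Lemma ler_enorm_norm {R : realType} {d : nat} (x : 'rV[R]_d) :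
  enorm x <= d%:R * `|x|.
Proof.
have dx0 : 0 <= d%:R * `|x| by rewrite mulr_ge0.
rewrite -(@ler_pXn2r _ 2)// ?nnegrE ?enorm_ge0// sqr_enorm.
apply: (@le_trans _ _ (d%:R * `|x| ^+ 2)).
  have -> : d%:R * `|x| ^+ 2 = \sum_(i < d) `|x| ^+ 2.
    by rewrite sumr_const card_ord mulr_natl.
  apply: ler_sum => i _.
  by rewrite -expr2 -real_normK ?num_real// lerXn2r ?nnegrE// ler_coord.
rewrite exprMn ler_wpM2r ?sqr_ge0//.
by case: d x dx0 => [|d] x _; rewrite ?expr0n// ler_eXnr// ler1n.
Qed.

Lemma near_enorm {R : realType} {d : nat} (x : 'rV[R]_d) (e : R) : 0 < e ->
  \forall y \near x, enorm (y - x) < e.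
Proof.
(* [d + 1] rather than [d] makes the divisor positive when [d = 0] as well. *)
move=> e0; have d0 : 0 < d%:R + 1 :> R by rewrite ltr_wpDl.
near=> y; rewrite (le_lt_trans (ler_enorm_norm _))//.
have yx : `|y - x| < e / (d%:R + 1).
  near: y; apply/nbhs_ballP; exists (e / (d%:R + 1)); first by rewrite /= divr_gt0.
  by move=> z; rewrite -ball_normE /= distrC.
rewrite ltr_pdivlMr// in yx; rewrite (le_lt_trans _ yx)// mulrC ler_wpM2l//.
by rewrite lerDl.
Unshelve. all: by end_near. Qed.

Lemma nbhs_enormP {R : realType} {d : nat} (x : 'rV[R]_d) (A : set 'rV[R]_d) :
  nbhs x A <-> exists2 e, 0 < e & forall y, enorm (y - x) < e -> A y.
Proof.
split=> [/nbhs_ballP[e /= e0 eA]|[e e0 eA]].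
  exists e => // y xye; apply: eA; rewrite -ball_normE /= distrC.
  by rewrite (le_lt_trans (ler_norm_enorm _)).
by apply: filterS (near_enorm x e0).
Qed.

Lemma dist_enormB {R : realType} {d : nat} (x y : 'rV[R]_d) :
  `|enorm x - enorm y| <= enorm (x - y).
Proof.
rewrite ler_norml; have := ler_enormB x y 0; have := ler_enormB y x 0.
by rewrite !subr0 (enormC y x); lra.
Qed.

Lemma continuous_enorm {R : realType} {d : nat} (a : 'rV[R]_d) :
  continuous (fun y : 'rV[R]_d => enorm (y - a)).
Proof.
move=> x; apply/(@cvgrPdist_lt _ _ _ (nbhs x)) => e e0.
apply: filterS (near_enorm x e0) => y yx.
by rewrite (le_lt_trans (dist_enormB _ _))// opprB subrKA enormC.
Qed.

Lemma closed_ebound {R : realType} {d : nat} (a : 'rV[R]_d) (r : R) :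
  closed [set y | enorm (y - a) <= r].
Proof.
apply: (@closed_comp _ _ (fun y : 'rV[R]_d => enorm (y - a)) [set t | t <= r]).
  by move=> x _; exact: continuous_enorm.
exact: closed_le.
Qed.

Lemma compact_ebound {R : realType} {d : nat} (A : set 'rV[R]_d) (a : 'rV[R]_d) (r : R) :
  closed A -> (forall y, A y -> enorm (y - a) <= r) -> compact A.
Proof.
move=> clA Ar; apply: bounded_closed_compact => //.
exists (r + `|a|); split => [|M rM y /Ar yr]; first exact: num_real.
rewrite /= (le_trans _ (ltW rM))// -(subrK a y) (le_trans (ler_normD _ _))// lerD2r.
by rewrite (le_trans (ler_norm_enorm _)).
Qed.

(** * Nearest points *)

Lemma le_dist_set {R : realType} {d : nat} (M : set 'rV[R]_d) (x xi : 'rV[R]_d) :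
  M xi -> dist_set x M <= enorm (x - xi).
Proof.
move=> Mxi; apply: ge_inf; last by exists xi.
by exists 0 => _ [y _ <-]; exact: enorm_ge0.
Qed.

Lemma nearest_pointsP {R : realType} {d : nat} (M : set 'rV[R]_d) (x xi : 'rV[R]_d) :
  nearest_points M x xi <->
  M xi /\ forall eta, M eta -> enorm (x - xi) <= enorm (x - eta).
Proof.
split=> [[Mxi xd]|[Mxi xle]]; split=> //; first by move=> eta /le_dist_set; rewrite xd.
apply/eqP; rewrite eq_le le_dist_set// andbT lb_le_inf//.
  by exists (enorm (x - xi)), xi.
by move=> _ [eta Meta <-]; exact: xle.
Qed.

Lemma closest_pointP {R : realType} {d : nat} (M : set 'rV[R]_d) (x : 'rV[R]_d) :
  unpp M x -> M (closest_point M x) /\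
  forall eta, M eta -> enorm (x - closest_point M x) <= enorm (x - eta).
Proof.
by move=> [xi [xi_near _]]; apply/nearest_pointsP; exact: (xgetI 0 xi_near).
Qed.

Lemma closest_point_dist {R : realType} {d : nat} (M : set 'rV[R]_d) (x : 'rV[R]_d) :
  unpp M x -> enorm (x - closest_point M x) = dist_set x M.
Proof.
move=> xM; have [_ //] : nearest_points M x (closest_point M x).
by apply/nearest_pointsP; exact: closest_pointP.
Qed.

Lemma closest_point_unique {R : realType} {d : nat} (M : set 'rV[R]_d)
    (x xi : 'rV[R]_d) : unpp M x -> M xi ->
  enorm (x - xi) <= enorm (x - closest_point M x) -> xi = closest_point M x.
Proof.
move=> xM Mxi xle; have [_ pmin] := closest_pointP xM.
have [z [_ zu]] := xM; rewrite -(zu xi); last first.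
  by apply/nearest_pointsP; split=> // eta /pmin; exact: le_trans.
by apply: zu; apply/nearest_pointsP; exact: closest_pointP.
Qed.

Lemma closest_point_id {R : realType} {d : nat} (M : set 'rV[R]_d) (x : 'rV[R]_d) :
  unpp M x -> M x -> closest_point M x = x.
Proof.
by move=> xM Mx; apply/esym/closest_point_unique => //; rewrite subrr enorm0 enorm_ge0.
Qed.

Lemma unpp_int_unpp {R : realType} {d : nat} (M : set 'rV[R]_d) (x : 'rV[R]_d) :
  unpp_int M x -> unpp M x.
Proof. exact: interior_subset. Qed.

(* A competitor [z] in the closure would be the only possible nearest point of
   the points between [x] and [z], some of which lie in [unpp M]. *)
Lemma closest_point_unique_closure {R : realType} {d : nat} (M : set 'rV[R]_d)
    (x z : 'rV[R]_d) : unpp_int M x -> closure M z ->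
  enorm (x - z) <= enorm (x - closest_point M x) -> z = closest_point M x.
Proof.
move=> xM Mz xz; have uM := unpp_int_unpp xM.
have [Mp pmin] := closest_pointP uM.
set p := closest_point M x in Mp pmin xz *.
(* A lower bound for distances to [M] passes to the closure, in particular to [z]. *)
have clmin y q : (forall eta, M eta -> enorm (y - q) <= enorm (y - eta)) ->
    enorm (y - q) <= enorm (y - z).
  move=> qmin; apply/ler_addgt0Pr => e e0.
  have [eta [Meta etaz]] := Mz _ (near_enorm z e0).
  rewrite (le_trans (qmin _ Meta))// (le_trans (ler_enormB _ z _))// lerD2l.
  by rewrite enormC ltW.
have {xz} xz : enorm (x - z) = enorm (x - p) by apply/eqP; rewrite eq_le xz clmin.
have [e e0 eM] := (nbhs_enormP _ _).1 xM.
have [zx|zx] := eqVneq (enorm (x - z)) 0.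
  move/eqP: (zx); rewrite enorm_eq0 subr_eq0 => /eqP <-.
  by move/esym/eqP: xz; rewrite zx enorm_eq0 subr_eq0 => /eqP.
have zx0 : 0 < enorm (x - z) by rewrite lt_neqAle eq_sym zx enorm_ge0.
(* The first bound gives [t < 1], the second keeps [y] within [e] of [x], hence in [unpp M]. *)
pose t := Num.min (1 / 2) (e / 2 / enorm (x - z)).
have t0 : 0 < t by rewrite lt_min !divr_gt0.
have t1 : t < 1 by rewrite (@le_lt_trans _ _ (1 / 2))// ?ge_min ?lexx//; lra.
pose y := x + t *: (z - x).
have yM : unpp M y.
  apply: eM; rewrite /y addrC addKr enormZ gtr0_norm// enormC.
  rewrite (@le_lt_trans _ _ (e / 2))//; last by lra.
  by rewrite -ler_pdivlMr// /t ge_min lexx orbT.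
have [Mq qmin] := closest_pointP yM; set q := closest_point M y in Mq qmin.
have yz : y - z = (1 - t) *: (x - z).
  by rewrite /y; apply/rowP => i; rewrite !mxE; ring.
have qy : enorm (y - q) <= (1 - t) * enorm (x - z).
  by rewrite (le_trans (clmin _ _ qmin))// yz enormZ ger0_norm// subr_ge0 ltW.
(* [|x - q| <= |x - y| + |y - q| <= t |x - z| + (1 - t) |x - z| = |x - p|], so uniqueness at [x]
   applies to [q]. *)
have qp : q = p.
  rewrite /p; apply: (closest_point_unique uM Mq); rewrite -/p -xz.
  rewrite (le_trans (ler_enormB _ y _))//.
  have -> : enorm (x - y) = t * enorm (x - z).
    by rewrite /y opprD addNKr -scalerN enormZ gtr0_norm// opprB.
  by rewrite -lerBrDl (le_trans qy)// mulrBl mul1r.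
(* With [a = x - p] and [b = z - p], equal distances mean [|b|^2 = 2 a.b]. Hence
   [|y - p|^2 = (1 - t)^2 |a|^2 + t |b|^2], while [|y - p| <= (1 - t) |a|]. *)
clearbody t; have zp0 : dot (z - p) (z - p) = 0.
  apply/eqP; rewrite eq_le dot_ge0 andbT -(pmulr_rle0 _ t0).
  have : enorm (y - p) ^+ 2 <= ((1 - t) * enorm (x - z)) ^+ 2.
    by rewrite -qp lerXn2r ?nnegrE ?enorm_ge0// (le_trans (enorm_ge0 _) qy).
  have : dot (x - z) (x - z) = dot (x - p) (x - p) by rewrite -!sqr_enorm xz.
  rewrite exprMn xz !sqr_enorm.
  have -> : y - p = (1 - t) *: (x - p) + t *: (z - p).
    by rewrite /y; apply/rowP => i; rewrite !mxE; ring.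
  have -> : x - z = (x - p) - (z - p) by rewrite opprB addrA subrK.
  move: (x - p) (z - p) => a b; rewrite !dotE (dotC b a).
  move: (dot a a) (dot a b) (dot b b) t0 t1 => A B C; clear => t0 t1 h1 h2.
  have h3 : C = 2 * B by lra.
  by rewrite h3 in h2 *; nra.
by move/eqP: zp0; rewrite dot_eq0 subr_eq0 => /eqP.
Qed.

(** The points of the closure of [M] near [x] but at least [e] away from [p] form a compact set [K].
    Uniqueness in the closure puts [K] at distance at least [r + 2 del] from [x], whereas the
    nearest point of [y] is within [r + 2 |y - x|] of [x]. The radius [r + 2] in [K] allows for all
    [y] with [|y - x| < 1]. *)
Lemma closest_point_cont {R : realType} {d : nat} (M : set 'rV[R]_d) (x : 'rV[R]_d) :
  unpp_int M x -> {for x, continuous (closest_point M)}.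
Proof.
move=> xM; have uM := unpp_int_unpp xM.
have [Mp pmin] := closest_pointP uM; set p := closest_point M x in Mp pmin *.
apply/(@cvgrPdist_lt _ _ _ (nbhs x)) => e e0; rewrite -/p.
suff : \forall y \near x, enorm (closest_point M y - p) < e.
  apply: filterS => y; rewrite enormC; exact/le_lt_trans/ler_norm_enorm.
set r := enorm (x - p).
pose K := closure M `&` [set y | enorm (y - x) <= r + 2] `&`
  [set y | e <= enorm (y - p)].
have cK : compact K.
  apply: (@compact_ebound _ _ _ x (r + 2)) => [|y [[]]//].
  apply: closedI; first by apply: closedI; [exact: closed_closure|exact: closed_ebound].
  apply: (@closed_comp _ _ (fun y : 'rV[R]_d => enorm (y - p)) [set t | e <= t]).
    by move=> y _; exact: continuous_enorm.
  exact: closed_ge.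
have [del del0 Kdel] : exists2 del, 0 < del & forall y, K y -> r + 2 * del <= enorm (y - x).
  have [->|K0] := eqVneq K set0; first by exists 1.
  have cf : {within K, continuous (fun y : 'rV[R]_d => enorm (y - x))}.
    by apply: continuous_subspaceT; exact: continuous_enorm.
  have [|z zK zmin] := compact_EVT_min _ cK cf; first exact/set0P.
  have {}zK := set_mem zK; exists ((enorm (z - x) - r) / 2); last first.
    by move=> y yK; have := zmin y (mem_set yK); lra.
  rewrite divr_gt0// subr_gt0 ltNge; apply/negP => zr.
  have zp : z = p by apply: closest_point_unique_closure => //; [case: zK => -[]|rewrite enormC].
  by case: zK => _ /=; rewrite zp subrr enorm0 leNgt e0.
have m0 : 0 < Num.min 1 del by rewrite lt_min ltr01.
near=> y; rewrite ltNge; apply/negP => ey.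
have yx : enorm (y - x) < Num.min 1 del by near: y; exact: near_enorm.
have yM : unpp M y by near: y; exact: xM.
have [Mq qmin] := closest_pointP yM; set q := closest_point M y in ey Mq qmin.
move: yx; rewrite lt_min => /andP[yx1 yxd]; clearbody q.
have qx2 : enorm (q - x) <= r + 2 * enorm (y - x).
  have := ler_enormB q y x; rewrite (enormC q y).
  have := qmin _ Mp; have := ler_enormB y x p; rewrite -/r.
  by clearbody r; lra.
have /Kdel : K q.
  split=> //; split; first exact: subset_closure.
  by rewrite /=; clearbody r; lra.
by clearbody r; lra.
Unshelve. all: by end_near. Qed.

(** * Growth of the distance away from the set *)

Lemma dist_set_lip {R : realType} {d : nat} (M : set 'rV[R]_d) (x y : 'rV[R]_d) :
  M !=set0 -> dist_set y M <= dist_set x M + enorm (y - x).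
Proof.
move=> [z Mz]; rewrite -lerBlDr; apply: lb_le_inf; first by exists (enorm (x - z)), z.
move=> _ [eta Meta <-]; have := le_dist_set y Meta; have := ler_enormB y x eta; lra.
Qed.

Lemma continuous_dist_set {R : realType} {d : nat} (M : set 'rV[R]_d) :
  M !=set0 -> continuous (fun y : 'rV[R]_d => dist_set y M).
Proof.
move=> M0 x; apply/(@cvgrPdist_lt _ _ _ (nbhs x)) => e e0.
apply: filterS (near_enorm x e0) => y yx; rewrite ltr_distlC.
have := dist_set_lip x y M0; have := dist_set_lip y x M0.
by rewrite (enormC x y); lra.
Qed.

(** By continuity the nearest point [q] of [y] is within [r (1 - c)] of [p], so Cauchy-Schwarz gives
    [(x - p).(x - q) >= c r^2]. Expanding, [|y - q|^2 >= r^2 + 2 c r t + t^2 >= (r + c t)^2].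
    Quantifying [t] inside the neighbourhood lets one neighbourhood serve all small [t]. *)
Lemma dist_set_slope {R : realType} {d : nat} (M : set 'rV[R]_d) (x : 'rV[R]_d) (c : R) :
  unpp_int M x -> ~ M x -> 0 <= c -> c < 1 ->
  \forall y \near x, forall t, 0 < t ->
    y = x + t *: ((enorm (x - closest_point M x))^-1 *: (x - closest_point M x)) ->
    dist_set x M + c * t <= dist_set y M.
Proof.
move=> xM nMx c0 c1; have uM := unpp_int_unpp xM.
have [Mp pmin] := closest_pointP uM; have cp := closest_point_cont xM.
rewrite -(closest_point_dist uM).
have r0 : 0 < enorm (x - closest_point M x).
  rewrite lt_neqAle enorm_ge0 andbT eq_sym enorm_eq0 subr_eq0.
  by apply/eqP => xp; apply: nMx; rewrite xp.
have eta0 : 0 < enorm (x - closest_point M x) * (1 - c) by rewrite mulr_gt0// subr_gt0.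
have cp' := cp _ (near_enorm (closest_point M x) eta0).
move: Mp pmin r0 eta0 cp' {cp}; move: (closest_point M x) => p Mp pmin r0 eta0 cp'.
near=> y; move=> t t0 yE.
have yM : unpp M y by near: y; exact: xM.
rewrite -(closest_point_dist yM).
have : enorm (closest_point M y - p) < enorm (x - p) * (1 - c) by near: y; exact: cp'.
have [Mq qmin] := closest_pointP yM.
move: (closest_point M y) Mq qmin => q Mq qmin qp.
have [r rE] : exists r, r = enorm (x - p) by exists (enorm (x - p)).
rewrite -!rE in r0 eta0 qp pmin *; have ct0 : 0 <= r + c * t by rewrite addr_ge0 ?mulr_ge0// ltW.
rewrite -(@ler_pXn2r _ 2)// ?nnegrE ?enorm_ge0//.
have xq : r ^+ 2 <= enorm (x - q) ^+ 2 by rewrite lerXn2r ?nnegrE ?enorm_ge0 ?(ltW r0)// pmin.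
have xpq : r * (r * c) <= dot (x - p) (x - q).
  have -> : x - q = (x - p) - (q - p) by rewrite opprB addrA subrK.
  rewrite dotBr -sqr_enorm; have := cauchy_schwarz (x - p) (q - p); rewrite -rE.
  have : r * enorm (q - p) <= r * (r * (1 - c)) by rewrite ler_pM2l// ltW.
  lra.
have -> : y - q = (x - q) + (t * r^-1) *: (x - p).
  by rewrite yE scalerA -rE addrAC.
move: (x - q) (x - p) xq xpq rE => a b xq xpq rE.
rewrite sqr_enorm !dotE (dotC a b) -(sqr_enorm a) -(sqr_enorm b) -rE.
have -> : t / r * (t / r * r ^+ 2) = t ^+ 2 by field; rewrite gt_eqF.
have h : t * (r * c) <= t / r * dot b a.
  by rewrite -mulrA ler_pM2l// ler_pdivlMl.
have h2 : c * t * (c * t) <= t * t.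
  have ct : c * t <= t by rewrite ler_piMl// ltW.
  by rewrite ler_pM// mulr_ge0// ltW.
move: xq h h2; move: (dot _ _) (enorm a) => A B; clear; nra.
Unshelve. all: by end_near. Qed.

(* The slope estimate lets one climb: a maximiser of the distance among the
   [y] with [dist_set y M >= dist_set x M + c |y - x|] lies on the boundary. *)
Lemma dist_set_climb {R : realType} {d : nat} (M : set 'rV[R]_d) (x : 'rV[R]_d)
    (c e : R) : 0 < e ->
  (forall y, enorm (y - x) <= e -> unpp_int M y /\ ~ M y) -> 0 <= c -> c < 1 ->
  exists2 y, enorm (y - x) <= e & dist_set x M + c * e <= dist_set y M.
Proof.
move=> e0 xe c0 c1; have xx : enorm (x - x) <= e by rewrite subrr enorm0 ltW.
have M0 : M !=set0.
  exists (closest_point M x).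
  by have [/unpp_int_unpp /closest_pointP[]] := xe _ xx.
pose f y := dist_set y M - c * enorm (y - x).
have cf : continuous f.
  move=> y; apply: (@cvgB _ _ _ (nbhs y)); first exact: continuous_dist_set.
  by apply: (@cvgMl_tmp _ _ (nbhs y)); exact: continuous_enorm.
pose K := [set y | enorm (y - x) <= e] `&` [set y | dist_set x M <= f y].
have cK : compact K.
  apply: (@compact_ebound _ _ _ x e) => [|y []//].
  apply: closedI; first exact: closed_ebound.
  apply: (@closed_comp _ _ f [set t | dist_set x M <= t]); last exact: closed_ge.
  by move=> y _; exact: cf.
have K0 : K !=set0 by exists x; split=> //; rewrite /f /= subrr enorm0 mulr0 subr0.
have cd : {within K, continuous (fun y : 'rV[R]_d => dist_set y M)}.
  by apply: continuous_subspaceT; exact: continuous_dist_set.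
have [y yK ymax] := compact_EVT_max K0 cK cd.
have [/= ye yf] := set_mem yK; exists y => //.
have [yx|yx] := eqVneq (enorm (y - x)) e; first by move: yf; rewrite /f yx; lra.
have {}yx : enorm (y - x) < e by rewrite lt_neqAle yx.
exfalso; have [yM nMy] := xe _ ye; have uM := unpp_int_unpp yM.
set nu := (enorm (y - closest_point M y))^-1 *: (y - closest_point M y).
have nu1 : enorm nu = 1.
  rewrite /nu enormZ ger0_norm ?invr_ge0 ?enorm_ge0// mulVf// enorm_eq0 subr_eq0.
  by apply/eqP => yp; apply: nMy; rewrite yp; have [] := closest_pointP uM.
(* This slope is at least [c], which keeps the displaced point [z] in [K], and it is positive even
   if [c = 0], which makes the distance at [z] strictly larger than the maximum. *)
have c'1 : (c + 1) / 2 < 1 by lra.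
have c'0 : 0 <= (c + 1) / 2 by lra.
have [del del0 Hdel] := (nbhs_enormP _ _).1 (dist_set_slope yM nMy c'0 c'1).
pose t := Num.min (del / 2) (e - enorm (y - x)).
have t0 : 0 < t by rewrite lt_min divr_gt0// subr_gt0.
have td : t < del by rewrite (@le_lt_trans _ _ (del / 2))// ?ge_min ?lexx//; lra.
have te : t <= e - enorm (y - x) by rewrite ge_min lexx orbT.
clearbody t.
pose z := y + t *: nu.
have zy : enorm (z - y) = t by rewrite /z addrC addKr enormZ nu1 mulr1 gtr0_norm.
have zx : enorm (z - x) <= enorm (y - x) + t.
  by rewrite (le_trans (ler_enormB _ y _))// zy addrC.
have := Hdel z; rewrite zy => /(_ td _ t0 erefl) zd.
have : K z.
  have : c * enorm (z - x) <= c * (enorm (y - x) + t) by rewrite ler_wpM2l.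
  have : c * t <= (c + 1) / 2 * t by rewrite ler_pM2r//; lra.
  split; rewrite /= ?(le_trans zx) ?[leRHS]subrK//; first lra.
  by move: yf; rewrite /f; lra.
move=> /mem_set /ymax; rewrite leNgt => /negP; apply.
have : 0 < (c + 1) / 2 * t by rewrite mulr_gt0//; lra.
lra.
Qed.

(** Climbing with slopes tending to 1 produces [y] with [|y - x| <= e] and distance at least [r + e]
    to [M]. Such a [y] can only be the point at distance [e] behind [x] on the ray from [p], which
    gives [k = e / r]. *)
Lemma closest_point_extend {R : realType} {d : nat} (M : set 'rV[R]_d)
    (x : 'rV[R]_d) : unpp_int M x -> ~ M x ->
  exists2 k, 0 < k & forall eta, M eta ->
    (1 + k) * enorm (x - closest_point M x) <=
    enorm (closest_point M x + (1 + k) *: (x - closest_point M x) - eta).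
Proof.
move=> xM nMx; have uM := unpp_int_unpp xM.
have [Mp pmin] := closest_pointP uM; have dE := closest_point_dist uM.
move: Mp pmin dE; move: (closest_point M x) => p Mp pmin dE.
have [r rE] : exists r, r = enorm (x - p) by exists (enorm (x - p)).
have r0 : 0 < r.
  rewrite rE lt_neqAle enorm_ge0 andbT eq_sym enorm_eq0 subr_eq0.
  by apply/eqP => xp; apply: nMx; rewrite xp.
rewrite -!rE in pmin dE *.
have [e' e'0 He'] := (nbhs_enormP _ _).1 (nbhs_interior xM).
(* [e < e'] keeps the closed ball about [x] in [unpp_int M]; [e < r] keeps it off [M]. *)
pose e := Num.min (e' / 2) (r / 2).
have e0 : 0 < e by rewrite lt_min !divr_gt0.
have ee' : e < e' by rewrite (@le_lt_trans _ _ (e' / 2))// ?ge_min ?lexx//; lra.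
have er : e < r by rewrite (@le_lt_trans _ _ (r / 2))// ?ge_min ?lexx ?orbT//; lra.
clearbody e.
have xe y : enorm (y - x) <= e -> unpp_int M y /\ ~ M y.
  move=> yx; split; first by apply: He'; rewrite (le_lt_trans yx).
  move=> /pmin; rewrite enormC leNgt => /negP; apply.
  exact: le_lt_trans er.
have M0 : M !=set0 by exists p.
have cd : {within [set y | enorm (y - x) <= e], continuous (fun y : 'rV[R]_d => dist_set y M)}.
  by apply: continuous_subspaceT; exact: continuous_dist_set.
have [||y /set_mem /= yx ymax] := compact_EVT_max _ _ cd.
- by exists x; rewrite /= subrr enorm0 ltW.
- by apply: (@compact_ebound _ _ _ x e) => //; exact: closed_ebound.
have yd : r + e <= dist_set y M.
  apply/ler_addgt0Pr => t t0; rewrite leNgt; apply/negP => se.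
  (* If the maximum were below [r + e], some [s < e] would exceed its gain over [r]; climbing with
     slope [s / e] reaches distance [r + s] and contradicts maximality. *)
  pose s := dist_set y M - r + t; have ys : dist_set y M - r < s by rewrite ltrDl.
  have {}se : s < e by rewrite /s addrAC ltrBlDl.
  clearbody s.
  have xy : dist_set x M <= dist_set y M.
    by apply: ymax; apply: mem_set; rewrite /= subrr enorm0 ltW.
  have s0 : 0 <= s by rewrite (le_trans _ (ltW ys))// subr_ge0 dE.
  have [|z /= zx] := dist_set_climb e0 xe (divr_ge0 s0 (ltW e0)).
    by rewrite ltr_pdivrMr// mul1r.
  rewrite divfK ?gt_eqF// leNgt => /negP; apply; rewrite -dE -ltrBlDl.
  by rewrite (le_lt_trans _ ys)// lerD2r; apply: ymax; exact: mem_set.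
(* Equality case of the triangle inequality: [|y - p| >= r + e] although [|y - x| <= e] and
   [|x - p| = r]. *)
have yE : y = p + (1 + e / r) *: (x - p).
  have /eqP : dot (y - x - (e / r) *: (x - p)) (y - x - (e / r) *: (x - p)) = 0.
    apply/eqP; rewrite eq_le dot_ge0 andbT.
    have : (r + e) ^+ 2 <= enorm (y - p) ^+ 2.
      rewrite lerXn2r ?nnegrE ?enorm_ge0 ?addr_ge0 ?(ltW r0) ?(ltW e0)//.
      exact/(le_trans yd)/le_dist_set.
    have : enorm (y - x) ^+ 2 <= e ^+ 2 by rewrite lerXn2r ?nnegrE ?enorm_ge0 ?(ltW e0).
    rewrite !sqr_enorm.
    have -> : y - p = (y - x) + (x - p) by rewrite subrKA.
    have xpE : dot (x - p) (x - p) = r ^+ 2 by rewrite -sqr_enorm -rE.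
    move: (y - x) (x - p) xpE => a b abE; rewrite !dotE (dotC b a) abE => h1 h2.
    have k0 : 0 < e / r by rewrite divr_gt0.
    have -> : e = (e / r) * r by rewrite divfK// gt_eqF.
    have {}h1 : dot a a <= ((e / r) * r) ^+ 2 by rewrite divfK// gt_eqF.
    have {}h2 : (r + (e / r) * r) ^+ 2 <= dot a a + dot a b + (dot a b + r ^+ 2).
      by rewrite divfK// gt_eqF.
    have -> : (e / r) * r / r = e / r by rewrite mulfK// gt_eqF.
    move: (e / r) k0 h1 h2 => k; move: (dot a a) (dot a b) => A B k0 h1 h2.
    have : k * (2 * B) >= k * (2 * k * r ^+ 2 + (k * r) ^+ 2 - A).
      by rewrite ler_pM2l//; nra.
    have : (1 + k) * (A - (k * r) ^+ 2) <= 0.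
      by rewrite pmulr_rle0 ?subr_le0//; lra.
    nra.
  rewrite dot_eq0 subr_eq0 => /eqP yxE; rewrite scalerDl scale1r -yxE.
  by rewrite addrA [p + _]addrC subrK addrC subrK.
exists (e / r); first by rewrite divr_gt0.
move=> eta Meta; rewrite -yE mulrDl mul1r divfK ?gt_eqF//.
exact/(le_trans yd)/le_dist_set.
Qed.

(** Off [M], put [a = x - p] and [b = eta - p]. The larger ball gives
    [|(1 + k) a - b| >= (1 + k) |a|], that is, [2 a.b <= |b|^2 / (1 + k)]; inserted into [|a - b|^2]
    this leaves the surplus [k / (1 + k) |b|^2]. On [M], [p = x] and the constant 1 works. *)
Lemma closest_point_quadratic_growth {R : realType} {d : nat} (M : set 'rV[R]_d)
    (x : 'rV[R]_d) : unpp_int M x ->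
  exists2 k, 0 < k & forall eta, M eta ->
    enorm (x - closest_point M x) ^+ 2 + k * enorm (eta - closest_point M x) ^+ 2
    <= enorm (x - eta) ^+ 2.
Proof.
move=> xM; have [Mx|nMx] := pselect (M x).
  exists 1 => // eta _; rewrite (closest_point_id (unpp_int_unpp xM) Mx).
  by rewrite subrr enorm0 expr0n add0r mul1r (enormC eta).
have [k k0 kM] := closest_point_extend xM nMx.
move: kM; move: (closest_point M x) => p kM.
exists (k / (1 + k)) => [|eta Meta].
  by rewrite divr_gt0// ltr_wpDr// ltW.
have k1 : 0 < 1 + k by rewrite ltr_wpDl.
have := kM _ Meta; rewrite -(@ler_pXn2r _ 2)// ?nnegrE ?mulr_ge0 ?enorm_ge0 ?(ltW k1)//.
rewrite exprMn !sqr_enorm.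
have -> : x - eta = (x - p) - (eta - p) by rewrite opprB addrA subrK.
have -> : p + (1 + k) *: (x - p) - eta = (1 + k) *: (x - p) - (eta - p).
  by rewrite opprB addrCA addrA.
move: (x - p) (eta - p) => a b; rewrite !dotE (dotC b a) => h.
have {}h : 2 * dot a b <= (1 + k)^-1 * dot b b.
  by rewrite -(ler_pM2l k1) mulVKf ?gt_eqF//; nra.
have -> : k / (1 + k) = 1 - (1 + k)^-1 by field; rewrite gt_eqF.
nra.
Qed.

(** * Differential calculus *)

Lemma differentiable_approx {R : numFieldType} {V W : normedModType R} (f : V -> W)
    (x : V) (e : R) : differentiable f x -> 0 < e ->
  \forall y \near x, `|f y - f x - 'd f x (y - x)| <= e * `|y - x|.
Proof.
move=> /diff_locallyP[_ /eqaddoP H] e0; have := H _ e0.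
rewrite [X in X -> _](near_shift x) => {}H.
apply: filterS H => y /=; rewrite sub0r.
by rewrite -[(_ - (cst _ + _)) _]/(f (shift x (y - x)) - (f x + 'd f x (y - x)))
  /= subrK opprD addrA.
Qed.

Lemma is_diff_approx {R : numFieldType} {V W : normedModType R} (f : V -> W)
    (L : {linear V -> W}) (x : V) : continuous L ->
  (forall e : R, 0 < e -> \forall y \near x, `|f y - f x - L (y - x)| <= e * `|y - x|) ->
  is_diff x f L.
Proof.
move=> cL fL; have fE : f \o shift x = cst (f x) + L +o_ 0 id.
  apply/eqaddoP => e e0.
  suff : \forall h \near (0 : V), `|f (h + x) - (f x + L h)| <= e * `|h| by [].
  rewrite (near_shift x); apply: filterS (fL _ e0) => y /=.
  by rewrite sub0r subrK opprD addrA.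
have dE : 'd f x = L :> (V -> W) by exact: diff_unique.
split=> //; apply/diff_locallyP; split; last by rewrite dE.
by rewrite dE.
Qed.

Lemma linear_rV_continuous {R : numFieldType} {d : nat} {W : normedModType R}
    (L : {linear 'rV[R]_d -> W}) : continuous L.
Proof.
have -> : L = \sum_i (fun x : 'rV[R]_d => x 0 i *: L (delta_mx 0 i)) :> ('rV[R]_d -> W).
  apply/funext => x; rewrite fct_sumE [in LHS](row_sum_delta x) linear_sum /=.
  by apply: eq_bigr => i _; rewrite linearZ.
move=> x; apply/differentiable_continuous/differentiable_sum => i.
exact/differentiableZl/differentiable_coord.
Qed.

Lemma differentiable_coord_comp {R : numFieldType} {V : normedModType R} {d : nat}
    (f : V -> 'rV[R]_d) (x : V) (i : 'I_d) : differentiable f x ->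
  is_diff x (fun y => f y 0 i) (fun v => 'd f x v 0 i).
Proof.
move=> df; pose c := fun y : 'rV[R]_d => y 0 i.
have lc : linear c by move=> a u v; rewrite /c !mxE.
pose cM := GRing.isLinear.Build _ _ _ _ _ lc.
pose cL : {linear 'rV[R]_d -> R} := HB.pack c cM.
have dc y : is_diff y c c.
  split; first exact: (@differentiable_coord _ 1 d y 0 i).
  exact: (diff_lin y (@linear_rV_continuous _ _ _ cL)).
exact: (@is_diff_comp _ _ _ _ f ('d f x) c c x (differentiableP df) (dc _)).
Qed.

Lemma differentiable_rV {R : numFieldType} {V : normedModType R} {d : nat}
    (f : V -> 'rV[R]_d) (x : V) :
  (forall i, differentiable (fun y => f y 0 i) x) -> differentiable f x.
Proof.
move=> df; have -> : f = \sum_i (fun y => f y 0 i *: delta_mx 0 i).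
  by apply/funext => y; rewrite fct_sumE [LHS]row_sum_delta.
by apply: differentiable_sum => i; exact: differentiableZl.
Qed.

Lemma is_diff_dot {R : realType} {V : normedModType R} {d : nat}
    (f g : V -> 'rV[R]_d) (x : V) : differentiable f x -> differentiable g x ->
  is_diff x (fun y => dot (f y) (g y))
    (fun v => dot ('d f x v) (g x) + dot (f x) ('d g x v)).
Proof.
move=> df dg.
have -> : (fun y => dot (f y) (g y)) = \sum_i (fun y => f y 0 i * g y 0 i).
  by apply/funext => y; rewrite fct_sumE.
have dfi i := differentiable_coord_comp i df.
have dgi i := differentiable_coord_comp i dg.
have dfgi i : is_diff x (fun y => f y 0 i * g y 0 i)
    (fun v => 'd f x v 0 i * g x 0 i + f x 0 i * 'd g x v 0 i).
  apply: is_diff_eq (is_diffM (dfi i) (dgi i)) _; apply/funext => v.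
  by rewrite addrC; congr (_ + _); rewrite [RHS]mulrC.
have dfgi_ex i : differentiable (fun y => f y 0 i * g y 0 i) x by case: (dfgi i).
split; first exact: differentiable_sum.
apply/funext => v; rewrite -deriveE; last exact: differentiable_sum.
rewrite derive_sum => [|i]; last exact: diff_derivable.
rewrite /dot -big_split /=; apply: eq_bigr => i _; rewrite deriveE//.
by have [_ /(congr1 (@^~ v))] := dfgi i.
Qed.

Lemma is_derive_line {R : realType} {V W : normedModType R} (f : V -> W) (a h : V) (t : R) :
  differentiable f (a + t *: h) ->
  is_derive t (1 : R) (fun s : R => f (a + s *: h)) ('d f (a + t *: h) h).
Proof.
move=> df; pose l := fun s : R => a + s *: h.
have dl : is_diff t l (fun s => s *: h).
  by apply: is_diff_eq (is_diffD (is_diff_cst a t) (is_diff_scalel t h)) _; rewrite add0r.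
have dfl : is_diff t (f \o l) ('d f (l t) \o (fun s => s *: h)).
  by apply: is_diff_comp; exact: differentiableP.
have [dfl1 dfl2] := dfl.
split; first exact: diff_derivable.
by rewrite deriveE// dfl2 /= scale1r.
Qed.

(* Only the differentiability part of the implicit function theorem: the
   implicit function [u] is given and known to be continuous. *)
Lemma is_diff_implicit {R : realFieldType} {X Y Z : normedModType R}
    (G : X * Y -> Z) (u : X -> Y) (S : {linear X -> Y}) (x : X) (c : R) :
  0 < c -> continuous S -> {for x, continuous u} -> differentiable G (x, u x) ->
  (\forall y \near x, G (y, u y) = G (x, u x)) ->
  (forall h, c * `|h| <= `|'d G (x, u x) (0, h)|) ->
  (forall k, 'd G (x, u x) (k, S k) = 0) -> is_diff x u S.
Proof.
move=> c0 cS cu dG Gu Gc GS; apply: is_diff_approx => // e e0.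
have [s s0 Ss] := linear_lipschitz cS.
have s1 : 0 < 2 * (1 + s) by rewrite mulr_gt0// addr_gt0.
(* With [k = y - x] and [H] the norm of the error [u y - u x - S k], the estimate below is
   [c H <= e' ((1 + s) |k| + H)]. The first bound on [e'] absorbs [H] into the left side, the second
   leaves [H <= e |k|]. *)
pose e' := Num.min (c / 2) (e * c / (2 * (1 + s))).
have e'0 : 0 < e' by rewrite lt_min !divr_gt0// mulr_gt0.
have e'c : e' <= c / 2 by rewrite ge_min lexx.
have e'e : e' * (2 * (1 + s)) <= e * c by rewrite -ler_pdivlMr// ge_min lexx orbT.
clearbody e'.
have cp : (fun y => (y, u y)) @ x --> (x, u x) by apply: cvg_pair; [exact: cvg_id|exact: cu].
have Ga := cp _ (differentiable_approx dG e'0).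
apply: filterS2 Gu Ga => y yE /=; rewrite yE subrr sub0r normrN.
rewrite -[(y, u y) - (x, u x)]/(y - x, u y - u x).
move: (y - x) (u y - u x) => k h H; move: H (Gc (h - S k)) (GS k).
have -> : (k, h) = (k, S k) + (0, h - S k).
  by rewrite -[RHS]/(k + 0, S k + (h - S k)) addr0 addrC subrK.
rewrite linearD => H1 H2 H3; rewrite H3 add0r in H1.
have : `|(k, S k) + (0, h - S k)| <= (1 + s) * `|k| + `|h - S k|.
  rewrite (le_trans (ler_normD _ _))// lerD//.
    rewrite prod_normE /= ge_max mulrDl mul1r lerDl mulr_ge0 ?(ltW s0)//=.
    by rewrite (le_trans (Ss k))// lerDr.
  by rewrite prod_normE /= normr0 ge_max lexx normr_ge0.
move: H1 H2; move: `|_ + _| `|'d _ _ _| `|h - _| `|k| (normr_ge0 k) (normr_ge0 (h - S k)).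
clear -c0 e0 s0 e'0 e'c e'e => N D H K K0 H0 h1 h2 h3.
have h4 : c * H <= e' * ((1 + s) * K + H).
  by rewrite (le_trans h2)// (le_trans h1)// ler_wpM2l// ltW.
have h5 : e' * H <= c / 2 * H by rewrite ler_wpM2r.
have h6 : e' * (2 * (1 + s)) * K <= e * c * K by rewrite ler_wpM2r.
rewrite -(ler_pM2l c0); lra.
Qed.

(** For vector values the mean value theorem is an equality only coordinate by coordinate: [t]
    depends on [i]. *)
Lemma mvt_coord {R : realType} {V : normedModType R} {d : nat} (f : V -> 'rV[R]_d)
    (a b : V) (i : 'I_d) :
  (forall t : R, 0 <= t <= 1 -> differentiable f (a + t *: (b - a))) ->
  exists2 t, 0 <= t <= 1 &
    (f b - f a) 0 i = 'd f (a + t *: (b - a)) (b - a) 0 i.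
Proof.
move=> df; pose g := fun t : R => f (a + t *: (b - a)) 0 i : R.
have dg (t : R) : 0 <= t <= 1 -> is_derive t (1 : R) g ('d f (a + t *: (b - a)) (b - a) 0 i).
  move=> t01; have [dfi dfiE] := differentiable_coord_comp i (df _ t01).
  have := is_derive_line dfi.
  by rewrite (congr1 (@^~ (b - a)) dfiE).
have [||t t01 tE] := @MVT_segment R g
  (fun t : R => 'd f (a + t *: (b - a)) (b - a) 0 i) 0 1 ler01.
- move=> t; rewrite in_itv /= => /andP[t0 t1].
  by apply: dg; rewrite !ltW.
- apply: derivable_within_continuous => t; rewrite in_itv /= => t01.
  by have [] := dg _ t01.
exists t; first by move: t01; rewrite in_itv.
move: tE; rewrite subr0 mulr1 => <-.
by rewrite /g scale1r scale0r addr0 !mxE subrKC.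
Qed.

Lemma segment_ball {R : realType} {V : normedModType R} (a b c : V) (e t : R) :
  `|a - c| < e -> `|b - c| < e -> 0 <= t <= 1 -> `|a + t *: (b - a) - c| < e.
Proof.
move=> ac bc /andP[t0 t1].
have -> : a + t *: (b - a) - c = (1 - t) *: (a - c) + t *: (b - c).
  rewrite scalerBl scale1r addrAC -[RHS]addrA; congr (_ + _).
  by rewrite [RHS]addrC -scalerBr opprB subrKA.
rewrite (le_lt_trans (ler_normD _ _))// !normrZ ger0_norm ?subr_ge0// (ger0_norm t0).
have h1 : (1 - t) * `|a - c| <= (1 - t) * Num.max `|a - c| `|b - c|.
  by rewrite ler_wpM2l ?subr_ge0// le_max lexx.
have h2 : t * `|b - c| <= t * Num.max `|a - c| `|b - c|.
  by rewrite ler_wpM2l// le_max lexx orbT.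
have : Num.max `|a - c| `|b - c| < e by rewrite gt_max ac.
move: h1 h2; move: `|_| `|_| (Num.max _ _) => A B C; lra.
Qed.

Lemma ler_norm_rV_linear {R : realType} {d n : nat} (L : {linear 'rV[R]_d -> 'rV[R]_n})
    (B : 'I_d -> R) (i : 'I_n) (h : 'rV[R]_d) :
  (forall j, `|L (delta_mx 0 j) 0 i| <= B j) ->
  `|L h 0 i| <= (\sum_j B j) * `|h|.
Proof.
move=> LB; rewrite [in leLHS](row_sum_delta h) linear_sum summxE.
rewrite (le_trans (ler_norm_sum _ _ _))// mulr_suml; apply: ler_sum => j _.
by rewrite linearZ mxE normrM mulrC ler_pM// ler_coord.
Qed.

(** Near [x] each partial derivative exceeds its norm at [x] by at most 1. The radius is quantified
    by [\near 0^'+] so that finitely many such statements can share one radius. *)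
Lemma Ck1_lipschitz {R : realType} {d n : nat} (U : set 'rV[R]_d)
    (f : 'rV[R]_d -> 'rV[R]_n) (x : 'rV[R]_d) : open U -> U x -> Ck 1 U f ->
  exists C : R, 0 <= C /\ \forall e \near 0^'+, forall a b,
    `|a - x| < e -> `|b - x| < e -> `|f b - f a| <= C * `|b - a|.
Proof.
move=> oU Ux [df cdf]; pose B j := `|'d f x (delta_mx 0 j)| + 1.
have B0 j : 0 <= B j by rewrite addr_ge0.
exists (\sum_j B j); split; first exact: sumr_ge0.
have : \forall y \near x, U y /\ forall j, `|'d f y (delta_mx 0 j)| <= B j.
  near=> y; split; first by near: y; exact: open_nbhs_nbhs.
  near: y; apply: filter_forall => j.
  have /(@cvgrPdist_lt _ _ _ (nbhs x)) := cdf (delta_mx 0 j) x Ux.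
  move=> /(_ 1 ltr01); apply: filterS => y; rewrite distrC => yx.
  rewrite -[in leLHS](subrK ('d f x (delta_mx 0 j)) ('d f y _)).
  by rewrite (le_trans (ler_normD _ _))// addrC lerD2l ltW.
move=> /nbhs_ballP[e0 /= e00 He0].
near=> e; move=> a b ax bx.
have ee0 : e < e0 by near: e; exact: nbhs_right_lt.
have abx (t : R) : 0 <= t <= 1 -> U (a + t *: (b - a)) /\
    forall j, `|'d f (a + t *: (b - a)) (delta_mx 0 j)| <= B j.
  move=> t01; apply: He0; rewrite -ball_normE /= distrC.
  by rewrite segment_ball// (lt_trans _ ee0).
apply: ler_rV_norm => [|i]; first by rewrite mulr_ge0// sumr_ge0.
have [|t t01 ->] := @mvt_coord _ _ _ f a b i.
  by move=> t /abx[Ut _]; exact: df.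
apply: ler_norm_rV_linear => j; have [_ /(_ j)] := abx _ t01.
exact/le_trans/ler_coord.
Unshelve. all: by end_near. Qed.

(** The mean value theorem turns a coordinate of the remainder into one of
    [('d f z - 'd f a) (b - a)], and the partial derivatives are Lipschitz. The bound is uniform in
    the base point [a], as needed when [a] runs through a piece of [M]. *)
Lemma Ck2_taylor {R : realType} {d n : nat} (U : set 'rV[R]_d)
    (f : 'rV[R]_d -> 'rV[R]_n) (x : 'rV[R]_d) : open U -> U x -> Ck 2 U f ->
  exists C : R, 0 <= C /\ \forall e \near 0^'+, forall a b,
    `|a - x| < e -> `|b - x| < e ->
    `|f b - f a - 'd f a (b - a)| <= C * `|b - a| ^+ 2.
Proof.
move=> oU Ux [df cdf].
have [C /all_and2[C0 HC]] := choice (fun j => Ck1_lipschitz oU Ux (cdf (delta_mx 0 j))).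
exists (\sum_j C j); split; first exact: sumr_ge0.
have /nbhs_ballP[e0 /= e00 He0] := open_nbhs_nbhs (conj oU Ux).
near=> e.
have ee0 : e < e0 by near: e; exact: nbhs_right_lt.
have He j a b : `|a - x| < e -> `|b - x| < e ->
    `|'d f b (delta_mx 0 j) - 'd f a (delta_mx 0 j)| <= C j * `|b - a|.
  by move: j a b; near: e; apply: filter_forall => j; exact: HC.
move=> a b ax bx.
have abx (t : R) : 0 <= t <= 1 -> `|a + t *: (b - a) - x| < e by exact: segment_ball.
apply: ler_rV_norm => [|i]; first by rewrite mulr_ge0 ?sqr_ge0// sumr_ge0.
have [|t t01] := @mvt_coord _ _ _ f a b i.
  move=> t /abx tx; apply/df/He0; rewrite -ball_normE /= distrC.
  exact: lt_trans ee0.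
rewrite [X in `|X|]mxE => ->; set z := a + t *: (b - a).
pose L := 'd f z \- 'd f a.
rewrite [X in `|X|](_ : _ = L (b - a) 0 i); last by rewrite /L !mxE.
have -> : (\sum_j C j) * `|b - a| ^+ 2 = (\sum_j C j * `|b - a|) * `|b - a|.
  by rewrite mulr_suml !mulr_suml; apply: eq_bigr => j _; rewrite expr2 mulrA.
apply: ler_norm_rV_linear => j; rewrite (le_trans (ler_coord _ _ _))//.
rewrite (le_trans (He j a z ax (abx _ t01)))// ler_wpM2l// /z addrC addKr normrZ.
by case/andP: t01 => t0 t1; rewrite ger0_norm// ler_piMl.
Unshelve. all: by end_near. Qed.

(** If [a < 0], then [g t <= a t / 2 < 0] for small [t > 0], and the mean value theorem takes [f]
    below its minimum. *)
Lemma min_second_derive {R : realType} (f g : R -> R) (a : R) :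
  (\forall t \near (0 : R), is_derive t (1 : R) f (g t)) -> g 0 = 0 ->
  is_derive (0 : R) (1 : R) g a ->
  (\forall t \near (0 : R), f 0 <= f t) -> 0 <= a.
Proof.
move=> df g0 [dg dga] fmin; rewrite leNgt; apply/negP => a0.
have e0 : 0 < - a / 2 by rewrite divr_gt0// oppr_gt0.
have {}dg : differentiable g 0 by exact/derivable1_diffP.
have dgE t : 'd g 0 t = t * a.
  by rewrite -[t in LHS]mulr1 -[t * 1]/(t *: 1) linearZ -deriveE// dga.
have := differentiable_approx dg e0.
move=> /(filterI fmin)/(filterI df)/nbhs_ballP[e /= e_gt0 He].
have t0 : 0 < e / 2 by rewrite divr_gt0.
have Ht (t : R) : 0 <= t <= e / 2 -> [/\ is_derive t (1 : R) f (g t), f 0 <= f t &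
    `|g t - g 0 - 'd g 0 (t - 0)| <= - a / 2 * `|t - 0|].
  move=> /andP[tge0 te]; have [|? [? ?] //] := He t.
  by rewrite -ball_normE /= sub0r normrN ger0_norm//; lra.
have [||t] := @MVT R f g 0 (e / 2) t0.
- move=> t; rewrite in_itv /= => /andP[t1 t2].
  by have [|//] := Ht t; rewrite !ltW.
- apply: derivable_within_continuous => t; rewrite in_itv /= => /Ht[[]//].
rewrite in_itv /= => /andP[t1 t2].
have [|_ _] := Ht t; first by rewrite !ltW.
rewrite g0 !subr0 dgE (gtr0_norm t1) ler_norml => /andP[_ gt].
have [|_ fe _ fE] := Ht (e / 2); first by rewrite lexx ltW.
have : g t < 0 by nra.
move=> gt0; have : g t * (e / 2) < 0 by rewrite nmulr_rlt0.
by rewrite -fE; lra.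
Qed.

(** * Coercive forms on a coordinate plane *)

(** R^m is kept inside R^d, so that charts and their differentials remain maps of R^d into
    itself. *)
Definition coord_plane {R : realType} {d : nat} (m : nat) : set 'rV[R]_d :=
  [set h | forall i : 'I_d, (m <= i)%N -> h 0 i = 0].

Lemma coord_planeP {R : realType} {d : nat} (m : nat) (a : R) (h k : 'rV[R]_d) :
  coord_plane m h -> coord_plane m k -> coord_plane m (a *: h + k).
Proof. by move=> hE kE i mi; rewrite !mxE hE// kE// mulr0 addr0. Qed.

Lemma coord_plane0 {R : realType} {d : nat} (m : nat) : coord_plane m (0 : 'rV[R]_d).
Proof. by move=> i _; rewrite mxE. Qed.

Lemma coord_planeZ {R : realType} {d : nat} (m : nat) (a : R) (h : 'rV[R]_d) :
  coord_plane m h -> coord_plane m (a *: h).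
Proof.
by move=> hE; rewrite -[_ *: _]addr0; apply: coord_planeP => //; exact: coord_plane0.
Qed.

Lemma coord_planeD {R : realType} {d : nat} (m : nat) (h k : 'rV[R]_d) :
  coord_plane m h -> coord_plane m k -> coord_plane m (h + k).
Proof. by move=> hE kE; rewrite -[h]scale1r; exact: coord_planeP. Qed.

Lemma coord_planeB {R : realType} {d : nat} (m : nat) (h k : 'rV[R]_d) :
  coord_plane m h -> coord_plane m k -> coord_plane m (h - k).
Proof. by move=> hE kE; rewrite addrC -scaleN1r; exact: coord_planeP. Qed.

Lemma coord_plane_delta {R : realType} {d : nat} (m : nat) (i : 'I_d) :
  (i < m)%N -> coord_plane m (delta_mx 0 i : 'rV[R]_d).
Proof.
move=> im j mj; rewrite mxE eqxx /=; case: eqP => // ji.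
by move: im; rewrite -ji ltnNge mj.
Qed.

Lemma coord_plane_linear_ext {R : realType} {d : nat} (m : nat)
    (f g : {linear 'rV[R]_d -> R}) :
  (forall i : 'I_d, (i < m)%N -> f (delta_mx 0 i) = g (delta_mx 0 i)) ->
  forall w, coord_plane m w -> f w = g w.
Proof.
move=> fg w wE; rewrite (row_sum_delta w) !linear_sum; apply: eq_bigr => i _.
rewrite !linearZ /=; have [mi|im] := leqP m i; first by rewrite wE// !scale0r.
by rewrite fg.
Qed.

(* Replacing the functionals [q h e_i], [i < m], by the remaining coordinates
   turns a problem on the plane into one with a square matrix. *)
Lemma coercive_unitmx {R : realType} {d : nat} (m : nat)
    (q : 'rV[R]_d -> 'rV[R]_d -> R) :
  (forall h a w z, q h (a *: w + z) = a * q h w + q h z) ->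
  (forall w a h k, q (a *: h + k) w = a * q h w + q k w) ->
  (forall h, coord_plane m h -> q h h = 0 -> h = 0) ->
  exists2 Q : 'M[R]_d, Q \in unitmx & forall h (i : 'I_d),
    (h *m Q) 0 i = if (i < m)%N then q h (delta_mx 0 i) else h 0 i.
Proof.
move=> qr ql q0.
pose Q := \matrix_(j, i) if (i < m)%N then q (delta_mx 0 j) (delta_mx 0 i)
  else (delta_mx 0 j : 'rV[R]_d) 0 i.
have QE h (i : 'I_d) : (h *m Q) 0 i = if (i < m)%N then q h (delta_mx 0 i) else h 0 i.
  have [im|mi] := ltnP i m.
    pose f := fun h => q h (delta_mx 0 i).
    have lf : linear f by move=> a u v; exact: ql.
    pose fL : {linear 'rV[R]_d -> R} := HB.pack f (GRing.isLinear.Build _ _ _ _ _ lf).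
    rewrite -[RHS]/(fL h) [in RHS](row_sum_delta h) linear_sum mxE.
    by apply: eq_bigr => j _; rewrite linearZ !mxE im.
  rewrite [in RHS](row_sum_delta h) mxE summxE.
  by apply: eq_bigr => j _; rewrite !mxE ltnNge mi.
exists Q => //; rewrite -row_free_unit; apply: inj_row_free => h hQ.
(* The last coordinates of [h *m Q = 0] put [h] in the plane; the first ones say that [q h] vanishes
   on the plane, in particular at [h]. *)
have hE : coord_plane m h by move=> i mi; have := QE h i; rewrite hQ mxE ltnNge mi.
apply: q0 => //.
have lq : linear (q h) by move=> a u v; exact: qr.
pose qL : {linear 'rV[R]_d -> R} := HB.pack (q h) (GRing.isLinear.Build _ _ _ _ _ lq).
pose z : {linear 'rV[R]_d -> R} := \0.
rewrite -[q h h]/(qL h) (coord_plane_linear_ext (g := z) _ hE)// => i im.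
by have := QE h i; rewrite hQ mxE im.
Qed.

(** Lax-Milgram in finite dimension. *)
Lemma coercive_solve {R : realType} {d : nat} (m : nat)
    (q : 'rV[R]_d -> 'rV[R]_d -> R) (l : {linear 'rV[R]_d -> R}) :
  (forall h a w z, q h (a *: w + z) = a * q h w + q h z) ->
  (forall w a h k, q (a *: h + k) w = a * q h w + q k w) ->
  (forall h, coord_plane m h -> q h h = 0 -> h = 0) ->
  exists2 h, coord_plane m h & forall w, coord_plane m w -> q h w = l w.
Proof.
move=> qr ql q0; have [Q Qu QE] := coercive_unitmx qr ql q0.
(* The zeros in the coordinates [m <= i] force the solution into the plane. *)
pose b := \row_(i < d) if (i < m)%N then l (delta_mx 0 i) else 0.
exists (b *m invmx Q) => [i mi|w wE].
  by have := QE (b *m invmx Q) i; rewrite mulmxKV// mxE ltnNge mi.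
set h := b *m invmx Q.
have lq : linear (q h) by move=> a u v; exact: qr.
pose qL : {linear 'rV[R]_d -> R} := HB.pack (q h) (GRing.isLinear.Build _ _ _ _ _ lq).
apply: (coord_plane_linear_ext (f := qL) _ wE) => i im.
by have := QE h i; rewrite /h mulmxKV// mxE im.
Qed.

(** [orthoproj] is an [xget] with default 0, so a foot point must be produced: it is [J h] with [h]
    the solution of the normal equations [(J h).(J w) = x.(J w)]. Injectivity of [J] on the plane
    makes their Gram form definite. *)
Lemma orthoprojP {R : realType} {d : nat} (m : nat) (J : {linear 'rV[R]_d -> 'rV[R]_d})
    (T : set 'rV[R]_d) (x y : 'rV[R]_d) :
  (forall h, coord_plane m h -> J h = 0 -> h = 0) ->
  T = [set J h | h in coord_plane m] ->
  (T y /\ forall z, T z -> dot (x - y) z = 0) <-> y = orthoproj T x.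
Proof.
move=> J0 ->; set P := [set J h | h in coord_plane m].
have Puniq u v : (P u /\ forall z, P z -> dot (x - u) z = 0) ->
    (P v /\ forall z, P z -> dot (x - v) z = 0) -> u = v.
  move=> [[h hE <-] hx] [[k kE <-] kx].
  have hk : P (J h - J k) by exists (h - k); [exact: coord_planeB|exact: raddfB].
  apply/eqP; rewrite -subr_eq0 -dot_eq0.
  have -> : dot (J h - J k) (J h - J k) =
      dot (x - J k) (J h - J k) - dot (x - J h) (J h - J k).
    by rewrite -dotBl; congr dot; rewrite opprB [RHS]addrC subrKA.
  by rewrite hx// kx// subrr.
have [h hE hx] : exists2 h, coord_plane m h &
    forall w, coord_plane m w -> dot (J h) (J w) = dot x (J w).
  pose l := dot x \o J.
  have ll : linear l by move=> a u v; rewrite /l /= linearP dotDr dotZr.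
  pose lL : {linear 'rV[R]_d -> R} := HB.pack l (GRing.isLinear.Build _ _ _ _ _ ll).
  apply: (@coercive_solve _ _ m (fun h w => dot (J h) (J w)) lL).
  - by move=> h a w z; rewrite linearP dotDr dotZr.
  - by move=> h a w z; rewrite linearP dotDl dotZl.
  - by move=> h hE /eqP; rewrite dot_eq0 => /eqP; exact: J0.
have PJh : P (J h) /\ forall z, P z -> dot (x - J h) z = 0.
  split; first by exists h.
  by move=> _ [w wE <-]; rewrite dotBl hx// subrr.
have Po : P (orthoproj P x) /\ forall z, P z -> dot (x - orthoproj P x) z = 0.
  rewrite /orthoproj; case: xgetP => [u _ //|/(_ (J h)) nP]; exact/False_rect/nP.
by split=> [yP|->//]; exact: Puniq.
Qed.

(** * Derivatives along lines and curves *)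

Lemma near_eq_is_diff {R : numFieldType} {V W : normedModType R} (f g : V -> W)
    (x : V) : {near x, f =1 g} -> differentiable f x -> is_diff x g ('d f x).
Proof.
move=> fg df; apply: is_diff_approx => [|e e0]; first exact: diff_continuous.
have fgx := nbhs_singleton fg.
by apply: filterS2 fg (differentiable_approx df e0) => y <-; rewrite -fgx.
Qed.

Lemma diff_eq_along {R : realType} {V W : normedModType R} (f : V -> W) (x v : V) :
  differentiable f x -> (\forall t \near (0 : R), f (x + t *: v) = f x) ->
  'd f x v = 0.
Proof.
move=> df fx; have df0 : differentiable f (x + (0 : R) *: v) by rewrite scale0r addr0.
have := is_derive_line df0; rewrite scale0r addr0 => -[_ <-].
rewrite (@near_eq_derive _ _ _ _ (cst (f x))) ?derive_cst//.
Qed.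

Lemma is_derive_dot {R : realType} {d : nat} (f g : R -> 'rV[R]_d) (t : R)
    (f' g' : 'rV[R]_d) :
  is_derive t (1 : R) f f' -> is_derive t (1 : R) g g' ->
  is_derive t (1 : R) (fun s => dot (f s) (g s)) (dot f' (g t) + dot (f t) g').
Proof.
move=> [/derivable1_diffP df <-] [/derivable1_diffP dg <-].
have [dfg dfgE] := is_diff_dot df dg.
split; first exact: diff_derivable.
by rewrite (deriveE _ dfg) (deriveE _ df) (deriveE _ dg) (congr1 (@^~ 1) dfgE).
Qed.

(** Along a curve in [M] through [p] the squared distance to [x] has a minimum at time 0, so its
    derivative vanishes there. *)
Lemma nearest_orthogonal {R : realType} {d : nat} (M : set 'rV[R]_d)
    (x p w : 'rV[R]_d) :
  (forall eta, M eta -> enorm (x - p) <= enorm (x - eta)) ->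
  tangent M p w -> dot (x - p) w = 0.
Proof.
move=> pmin [c [[e e0 [[dc _] cM]] c0 [dc0 c'0]]].
pose f t := dot (x - c t) (x - c t).
have df t : `]-e, e[%classic t ->
    is_derive t (1 : R) f (dot (- 'D_1 c t) (x - c t) + dot (x - c t) (- 'D_1 c t)).
  move=> te; have dct : is_derive t (1 : R) c ('D_1 c t).
    by apply: derivableP; apply: diff_derivable; exact: dc.
  have dxc : is_derive t (1 : R) (fun s => x - c s) (- 'D_1 c t).
    by have := is_deriveB (is_derive_cst x t 1) dct; rewrite sub0r.
  exact: is_derive_dot.
have e0' : (0 : R) \in `]-e, e[ by rewrite in_itv /= oppr_lt0 e0.
have := @derive1_at_min R f (- e) e 0.
have -> : - e <= e by rewrite ge0_cp// ltW.
move=> /(_ isT) H; have {H} : is_derive (0 : R) (1 : R) f 0.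
  apply: H => // t te; first by have [] := df _ te.
  by rewrite -enorm_le c0; apply/pmin/cM.
move=> [_ f0]; have [_] := df _ e0'; rewrite f0 c'0 c0 => /esym.
rewrite dotNl dotNr (dotC w) => /eqP; rewrite -opprD oppr_eq0 -mulr2n mulrn_eq0 /=.
by move/eqP.
Qed.

(** * Charts and tangent spaces *)

Definition chart {R : realType} {d : nat} (m : nat) (M U V : set 'rV[R]_d)
    (Psi Phi : 'rV[R]_d -> 'rV[R]_d) : Prop :=
  [/\ open U /\ open V,
      forall y, V y -> U (Psi y) /\ Phi (Psi y) = y,
      forall z, U z -> V (Phi z) /\ Psi (Phi z) = z,
      Ck 2 V Psi /\ Ck 2 U Phi &
      forall y, V y -> (M (Psi y) <-> coord_plane m y)].

Lemma submanifold_chart {R : realType} {d : nat} (m : nat) (M : set 'rV[R]_d)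
    (xi : 'rV[R]_d) : submanifold 2 m M -> M xi ->
  exists U V Psi Phi, chart m M U V Psi Phi /\ U xi.
Proof.
move=> [_ sM] /sM[U [V [Psi [oU oV Uxi [Phi [PsiK PhiK cPsi cPhi]] MP]]]].
by exists U, V, Psi, Phi.
Qed.

Lemma Ck1S {R : realType} {V W : normedModType R} (U : set V) (f : V -> W) :
  Ck 2 U f -> Ck 1 U f.
Proof.
move=> [df cdf]; split=> // v x Ux; apply: differentiable_continuous.
by have [dfv _] := cdf v; exact: dfv.
Qed.

Lemma diff_cancel {R : realType} {X Y : normedModType R} (f : X -> Y) (g : Y -> X)
    (x : X) (h : X) : differentiable f x -> differentiable g (f x) ->
  (\forall z \near x, g (f z) = z) -> 'd g (f x) ('d f x h) = h.
Proof.
move=> df dg gf.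
have dgf := differentiable_comp df dg.
have [_ dE] := near_eq_is_diff (g := id) gf dgf.
have := congr1 (@^~ h) (diff_comp df dg); rewrite /= => <-.
rewrite -(congr1 (@^~ h) dE).
by have [_ ->] := is_diff_id x.
Qed.

Lemma chart_nbhsU {R : realType} {d : nat} (m : nat) (M U V : set 'rV[R]_d) Psi Phi z :
  chart m M U V Psi Phi -> U z -> nbhs z U.
Proof. by move=> [[oU _] _ _ _ _] Uz; exact: open_nbhs_nbhs. Qed.

Lemma chart_nbhsV {R : realType} {d : nat} (m : nat) (M U V : set 'rV[R]_d) Psi Phi y :
  chart m M U V Psi Phi -> V y -> nbhs y V.
Proof. by move=> [[_ oV] _ _ _ _] Vy; exact: open_nbhs_nbhs. Qed.

Lemma chart_dPsiK {R : realType} {d : nat} (m : nat) (M U V : set 'rV[R]_d) Psi Phi y h :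
  chart m M U V Psi Phi -> V y -> 'd Phi (Psi y) ('d Psi y h) = h.
Proof.
move=> ch Vy; have nV := chart_nbhsV ch Vy; case: ch => _ PsiK _ [[dPsi _] [dPhi _]] _.
apply: diff_cancel; [exact: dPsi|by apply: dPhi; have [] := PsiK _ Vy|].
by apply: filterS nV => z /PsiK[].
Qed.

Lemma chart_dPsi_inj {R : realType} {d : nat} (m : nat) (M U V : set 'rV[R]_d)
    Psi Phi y h : chart m M U V Psi Phi -> V y -> 'd Psi y h = 0 -> h = 0.
Proof.
move=> ch Vy h0; rewrite -(chart_dPsiK h ch Vy).
have gen (L : {linear 'rV[R]_d -> 'rV[R]_d}) j : j = 0 -> L j = 0.
  by move=> ->; rewrite linear0.
exact: gen h0.
Qed.

Lemma chart_dPhiK {R : realType} {d : nat} (m : nat) (M U V : set 'rV[R]_d) Psi Phi z h :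
  chart m M U V Psi Phi -> U z -> 'd Psi (Phi z) ('d Phi z h) = h.
Proof.
move=> ch Uz; have nU := chart_nbhsU ch Uz; case: ch => _ _ PhiK [[dPsi _] [dPhi _]] _.
apply: diff_cancel; [exact: dPhi|by apply: dPsi; have [] := PhiK _ Uz|].
by apply: filterS nU => y /PhiK[].
Qed.

Lemma chart_plane {R : realType} {d : nat} (m : nat) (M U V : set 'rV[R]_d) Psi Phi z :
  chart m M U V Psi Phi -> U z -> M z <-> coord_plane m (Phi z).
Proof. by move=> [_ _ PhiK _ MP] /PhiK[/MP + PK]; rewrite PK. Qed.

Lemma near_line {R : realType} {V : normedModType R} (A : set V) (a h : V) (t : R) :
  nbhs (a + t *: h) A -> \forall s \near t, A (a + s *: h).
Proof.
have c : {for t, continuous (fun s : R => a + s *: h)}.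
  apply: (@cvgD _ _ _ (nbhs t)); first exact: cvg_cst.
  exact: scalel_continuous.
by move=> /c.
Qed.

Lemma near_eq_continuous {T U : topologicalType} (f g : T -> U) (x : T) :
  (\forall y \near x, f y = g y) -> {for x, continuous g} -> {for x, continuous f}.
Proof.
move=> fg cg; have fgx : f x = g x := nbhs_singleton fg.
suff : f @ x --> f x by []; rewrite fgx.
by apply: cvg_trans cg; apply: near_eq_cvg; apply: filterS fg => y ->.
Qed.

(** The curve is the chart image of the line [y + t h], which stays in the plane. *)
Lemma tangent_chart_image {R : realType} {d : nat} (m : nat) (M U V : set 'rV[R]_d)
    Psi Phi y h : chart m M U V Psi Phi -> V y -> coord_plane m y -> coord_plane m h ->
  tangent M (Psi y) ('d Psi y h).
Proof.
move=> ch Vy yE hE; have nV := chart_nbhsV ch Vy.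
have nVo := chart_nbhsV ch; case: ch => _ _ _ [cPsi _] MP.
have [dPsi cdPsi] := Ck1S cPsi.
have y0 : y + (0 : R) *: h = y by rewrite scale0r addr0.
have [e /= e0 He] : exists2 e : R, 0 < e & forall s, ball (0 : R) e s -> V (y + s *: h).
  by apply/nbhs_ballP; apply: near_line; rewrite y0.
have VI t : `]-e, e[%classic t -> V (y + t *: h).
  move=> te; apply: He; rewrite -ball_normE /= sub0r normrN.
  by move: te; rewrite /= in_itv /= ltr_norml.
pose c := fun t : R => Psi (y + t *: h).
have dc t : V (y + t *: h) -> is_derive t (1 : R) c ('d Psi (y + t *: h) h).
  by move=> Vt; apply: is_derive_line; exact: dPsi.
exists c; split.
- exists e => //; split; last first.
    by move=> t /VI Vt; apply/MP => //; exact: coord_planeD (coord_planeZ _ hE).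
  split=> [t /VI /dc[] /derivable1_diffP//|v t /VI Vt].
  have cc : (fun s : R => v *: 'd Psi (y + s *: h) h) @ t -->
      v *: 'd Psi (y + t *: h) h.
    apply: cvgZl_tmp.
    apply: (@cvg_comp _ _ _ (fun s : R => y + s *: h) (fun z => 'd Psi z h) _
      (nbhs (y + t *: h)) _ _ (cdPsi h _ Vt)).
    by move=> A; exact: near_line.
  have dcE s : V (y + s *: h) -> 'd c s v = v *: 'd Psi (y + s *: h) h.
    move=> /dc[/derivable1_diffP dcs <-].
    by rewrite (deriveE _ dcs) -linearZ; congr ('d c s _); rewrite /GRing.scale /= mulr1.
  apply: (near_eq_continuous _ cc).
  by apply: filterS (near_line (nVo _ Vt)) => s Vs; exact: dcE.
- by rewrite /c y0.
- by have := dc 0; rewrite y0; exact.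
Qed.

(** Read in the chart, a curve in [M] has vanishing coordinates [m <= i], hence so has its velocity.
    Thus the set of velocities of curves is a linear subspace. *)
Lemma tangent_chartP {R : realType} {d : nat} (m : nat) (M U V : set 'rV[R]_d)
    Psi Phi z w : chart m M U V Psi Phi -> U z -> M z ->
  tangent M z w <-> coord_plane m ('d Phi z w).
Proof.
move=> ch Uz Mz; have [VPz PPz] : V (Phi z) /\ Psi (Phi z) = z.
  by case: (ch) => _ _ PhiK _ _; exact: PhiK.
split=> [[c [[e e0 [[dc _] cM]] c0 dc0]]|wE]; last first.
  rewrite -{1}PPz -(chart_dPhiK w ch Uz); apply: (tangent_chart_image ch) => //.
  exact/(chart_plane ch Uz).
have e00 : `]-e, e[%classic (0 : R) by rewrite /= in_itv /= oppr_lt0 e0.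
have dcx := dc _ e00; have {dc0} [_ wE] := dc0.
have dPhi : differentiable Phi (c 0).
  by rewrite c0; case: (ch) => _ _ _ [_ [dPhi _]] _; exact: dPhi.
have dPc := differentiable_comp dcx dPhi.
move=> i mi; have [dPci dPciE] := differentiable_coord_comp i dPc.
have : 'd (fun t : R => (Phi \o c) t 0 i) 0 1 = 0.
  apply: diff_eq_along => //.
  have nU : nbhs (c 0) U by rewrite c0; exact: chart_nbhsU ch Uz.
  have := differentiable_continuous dcx nU => /= nUc.
  have nI : nbhs (0 : R) `]-e, e[%classic.
    by apply: open_nbhs_nbhs; split=> //; exact: interval_open.
  have plane0 t : U (c t) -> M (c t) -> (Phi \o c) t 0 i = 0.
    by move=> Ut Mt; have /(_ i mi) := (chart_plane ch Ut).1 Mt.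
  near=> t.
  have Ut : U (c t) by near: t; exact: nUc.
  have It : `]-e, e[%classic t by near: t; exact: nI.
  by rewrite add0r [t *: 1]mulr1 !plane0 ?c0//; exact: cM.
rewrite (congr1 (@^~ 1) dPciE).
have -> := congr1 (@^~ 1) (diff_comp dcx dPhi).
by rewrite /= -(deriveE _ dcx) wE c0.
Unshelve. all: by end_near. Qed.

(** * Local closedness and unique nearest points near the submanifold *)

(** [M] may fail to be closed in R^d, but within [U] it is the preimage under [Phi] of the closed
    plane. *)
Lemma chart_closed {R : realType} {d : nat} (m : nat) (M U V : set 'rV[R]_d)
    Psi Phi (B : set 'rV[R]_d) : chart m M U V Psi Phi -> closed B -> B `<=` U ->
  closed (M `&` B).
Proof.
move=> ch clB BU z zMB.
have Bz : B z by apply: clB; apply: closureS zMB => y [].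
split=> //; have Uz := BU _ Bz; apply/(chart_plane ch Uz) => i mi.
apply: contrapT => /eqP zi.
have dPhi : differentiable Phi z by case: (ch) => _ _ _ [_ [dPhi _]] _; exact: dPhi.
have [dPhii _] := differentiable_coord_comp i dPhi.
have /cvgr_neq0 /(_ zi) Phii := differentiable_continuous dPhii.
have [y [[My By] yi]] := zMB _ Phii.
by move/eqP: yi; apply; apply: (chart_plane ch (BU _ By)).1.
Qed.

(** The vector ['d Psi (Phi p) (Phi q - Phi p)] is tangent at [p], hence orthogonal to [a], and
    differs from [q - p] by a Taylor remainder. *)
Lemma chart_normal_secant {R : realType} {d : nat} (m : nat) (M U V : set 'rV[R]_d)
    Psi Phi xi : chart m M U V Psi Phi -> U xi ->
  exists2 C : R, 0 <= C & exists2 e, 0 < e & forall p q a,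
    M p -> M q -> enorm (p - xi) < e -> enorm (q - xi) < e ->
    (forall w, tangent M p w -> dot a w = 0) ->
    dot a (q - p) <= C * enorm a * enorm (q - p) ^+ 2.
Proof.
move=> ch Uxi; have nU := chart_nbhsU ch Uxi.
have [[oU oV] _ PhiK [cPsi cPhi] _] := ch.
have [Vy _] := PhiK _ Uxi.
have [C1 [C10 HC1]] := Ck2_taylor oV Vy cPsi.
have [C2 [C20 HC2]] := Ck1_lipschitz oU Uxi (Ck1S cPhi).
have [e1 [He1 e10]] := filter_ex (filterI HC1 (nbhs_right_gt 0)).
have [e2 [He2 e20]] := filter_ex (filterI HC2 (nbhs_right_gt 0)).
(* [C1] bounds the Taylor remainder of [Psi], [C2] is a Lipschitz constant of [Phi], and [d] passes
   from the sup norm to the Euclidean one. *)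
exists (d%:R * C1 * C2 ^+ 2); first by rewrite !mulr_ge0.
have dPhi : differentiable Phi xi by case: cPhi => dPhi _; exact: dPhi.
have /(@cvgrPdist_lt _ _ _ (nbhs xi)) /(_ _ e10) Phin := differentiable_continuous dPhi.
have [e e0 He] := (nbhs_enormP _ _).1 (filterI nU (filterI Phin (near_enorm xi e20))).
 exists e => // p q a Mp Mq /He[Up [py p2]] /He[Uq [qy q2]] aT.
have [Vp Pp] := PhiK _ Up; have [Vq Pq] := PhiK _ Uq.
rewrite distrC in py; rewrite distrC in qy.
have pE := (chart_plane ch Up).1 Mp; have qE := (chart_plane ch Uq).1 Mq.
have aPsi : dot a ('d Psi (Phi p) (Phi q - Phi p)) = 0.
  apply: aT; rewrite -{1}Pp; apply: (tangent_chart_image ch) => //.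
  exact: coord_planeB.
have := He1 _ _ py qy; rewrite Pp Pq => h1.
have := He2 _ _ (le_lt_trans (ler_norm_enorm _) p2) (le_lt_trans (ler_norm_enorm _) q2).
move=> h2.
rewrite -[dot a _]subr0 -aPsi -dotBr (le_trans (cauchy_schwarz _ _))//.
rewrite [_ * enorm a]mulrC -[leRHS]mulrA ler_wpM2l ?enorm_ge0//.
rewrite (le_trans (ler_enorm_norm _))// -!mulrA ler_wpM2l// (le_trans h1)// ler_wpM2l//.
rewrite [leRHS]mulrA -expr2 -exprMn lerXn2r ?nnegrE ?normr_ge0 ?mulr_ge0 ?enorm_ge0// (le_trans h2)//.
by rewrite ler_wpM2l// ler_norm_enorm.
Qed.

(** Existence comes from compactness of [M] in a small ball. Two nearest points satisfy [|q - p|^2 =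
    2 (x - p).(q - p) <= 2 C |x - p| |q - p|^2], and [2 C |x - p| < 1]. *)
Lemma submanifold_sub_unpp_int {R : realType} {d : nat} (m : nat) (M : set 'rV[R]_d) :
  submanifold 2 m M -> M `<=` unpp_int M.
Proof.
move=> sM xi Mxi; have [U [V [Psi [Phi [ch Uxi]]]]] := submanifold_chart sM Mxi.
have [C C0 [e1 e10 HC]] := chart_normal_secant ch Uxi.
have [e2 e20 He2] := (nbhs_enormP _ _).1 (chart_nbhsU ch Uxi).
(* The three bounds place nearest points within reach of the secant estimate, the ball [B] inside
   the chart, and [2 rho C] below 1. *)
pose rho := Num.min (e1 / 2) (Num.min (e2 / 3) (1 / (4 * (C + 1)))).
have C1 : 0 < C + 1 by rewrite ltr_wpDl.
have rho0 : 0 < rho by rewrite !lt_min !divr_gt0// mulr_gt0.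
have rho1 : 2 * rho <= e1 by rewrite mulrC -ler_pdivlMr// /rho ge_min lexx.
have rho2 : 2 * rho < e2.
  have : rho <= e2 / 3 by rewrite /rho !ge_min lexx orbT.
  by move=> h; have : 0 < e2 := e20; clearbody rho; lra.
have rho3 : 2 * rho * C < 1.
  have : rho <= 1 / (4 * (C + 1)) by rewrite /rho !ge_min lexx !orbT.
  rewrite ler_pdivlMr ?mulr_gt0//; clearbody rho => h.
  have : 0 <= rho * C by rewrite mulr_ge0// ltW.
  nra.
clearbody rho; apply/nbhs_enormP; exists rho => // x xxi.
pose B := [set y | enorm (y - xi) <= 2 * rho].
have cMB : compact (M `&` B).
  apply: (@compact_ebound _ _ _ xi (2 * rho)) => [|y []//].
  apply: (chart_closed ch); first exact: closed_ebound.
  by move=> y yB; apply: He2; exact: le_lt_trans rho2.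
have MB0 : M `&` B !=set0.
  by exists xi; split=> //; rewrite /B /= subrr enorm0 mulr_ge0// ltW.
have cf : {within M `&` B, continuous (fun y : 'rV[R]_d => enorm (y - x))}.
  by apply: continuous_subspaceT; exact: continuous_enorm.
have [p /set_mem[Mp pB] pmin] := compact_EVT_min MB0 cMB cf.
(* A point of [M] outside [B] is more than [rho] away from [x], so [xi] already beats it. *)
have {}pmin eta : M eta -> enorm (x - p) <= enorm (x - eta).
  move=> Meta; rewrite enormC (enormC x eta).
  have [etaB|nB] := leP (enorm (eta - xi)) (2 * rho); first by apply: pmin; exact: mem_set.
  have := pmin xi; rewrite (enormC xi x) => /(_ (mem_set _)) h.
  rewrite (le_trans (h _))//; first by split=> //; rewrite /B /= subrr enorm0 mulr_ge0// ltW.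
  have := ler_enormB eta x xi; move: xxi nB.
  by clear; move: (enorm _) (enorm _) (enorm _) => *; lra.
exists p; split; first exact/nearest_pointsP.
move=> q /nearest_pointsP[Mq qmin].
have near_xi z : M z -> (forall eta, M eta -> enorm (x - z) <= enorm (x - eta)) ->
    enorm (z - xi) < e1.
  move=> Mz /(_ _ Mxi) h; rewrite (lt_le_trans _ rho1)//.
  have := ler_enormB z x xi; rewrite (enormC z x); move: xxi h.
  by clear; move: (enorm _) (enorm _) (enorm _) => *; lra.
have pq : enorm (x - p) = enorm (x - q) by apply/eqP; rewrite eq_le pmin// qmin.
have := HC p q (x - p) Mp Mq (near_xi _ Mp pmin) (near_xi _ Mq qmin).
move=> /(_ (fun w => nearest_orthogonal pmin)); rewrite sqr_enorm.
have xp : enorm (x - p) < rho by rewrite (le_lt_trans (pmin _ Mxi)).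
have : dot (q - p) (q - p) = 2 * dot (x - p) (q - p).
  have : dot (x - p) (x - p) = dot (x - q) (x - q) by rewrite -!sqr_enorm pq.
  have -> : x - q = (x - p) - (q - p) by rewrite opprB addrA subrK.
  move: (x - p) (q - p) => a b; rewrite !dotE (dotC b a).
  by move: (dot _ _) (dot _ _) (dot _ _) => X Y Z; clear => h; lra.
move=> bE ab; apply/eqP; rewrite eq_sym -subr_eq0 -dot_eq0 eq_le dot_ge0 andbT.
have b0 := dot_ge0 (q - p); have a0 := enorm_ge0 (x - p).
have : 2 * (C * enorm (x - p) * dot (q - p) (q - p)) <= 2 * rho * C * dot (q - p) (q - p).
  rewrite !mulrA ler_wpM2r// -!mulrA ler_wpM2l// mulrC ler_wpM2r//.
  exact: ltW.
move: rho3 bE ab b0; move: (dot _ _) (dot _ _) (enorm _) => X Y Z; clear.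
nra.
Qed.

(** * Second derivative of the squared distance *)

(** The second derivative [D^2 Psi(y)[h, w]], built from the maps ['d Psi z w] in terms of which
    [Ck] is stated. *)
Definition diff2 {R : realType} {d : nat} (Psi : 'rV[R]_d -> 'rV[R]_d)
    (y h w : 'rV[R]_d) : 'rV[R]_d := 'd (fun z => 'd Psi z w) y h.

(** For [a = x - Psi y] this is half the Hessian of [|x - Psi|^2] at [y]. If [a = r v] is normal, it
    is the first fundamental form minus [r] times the second one in direction [v], that is,
    [id - r L] in the chart. *)
Definition second_form {R : realType} {d : nat} (Psi : 'rV[R]_d -> 'rV[R]_d)
    (y a h w : 'rV[R]_d) : R :=
  dot ('d Psi y h) ('d Psi y w) - dot a (diff2 Psi y h w).

Lemma second_form_linearl {R : realType} {d : nat} (Psi : 'rV[R]_d -> 'rV[R]_d)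
    (y a w : 'rV[R]_d) (b : R) (h k : 'rV[R]_d) :
  second_form Psi y a (b *: h + k) w =
  b * second_form Psi y a h w + second_form Psi y a k w.
Proof.
have E1 : 'd Psi y (b *: h + k) = b *: 'd Psi y h + 'd Psi y k by exact: linearP.
have E2 : diff2 Psi y (b *: h + k) w = b *: diff2 Psi y h w + diff2 Psi y k w.
  exact: linearP.
by rewrite /second_form E1 E2 !dotE; ring.
Qed.

(** Linearity in [w], unlike in [h], concerns the map being differentiated, hence the
    differentiability of each ['d Psi u w] in [u]. *)
Lemma second_form_linearr {R : realType} {d : nat} (V : set 'rV[R]_d)
    (Psi : 'rV[R]_d -> 'rV[R]_d) (y a h : 'rV[R]_d) (b : R) (w z : 'rV[R]_d) :
  Ck 2 V Psi -> V y ->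
  second_form Psi y a h (b *: w + z) =
  b * second_form Psi y a h w + second_form Psi y a h z.
Proof.
move=> [_ cPsi] Vy; rewrite /second_form.
have dw v : differentiable (fun u => 'd Psi u v) y by have [dv _] := cPsi v; exact: dv.
have E1 : diff2 Psi y h (b *: w + z) = b *: diff2 Psi y h w + diff2 Psi y h z.
  rewrite /diff2.
  have -> : (fun u => 'd Psi u (b *: w + z)) =
      b *: (fun u => 'd Psi u w) + (fun u => 'd Psi u z).
    by apply/funext => u; exact: linearP.
  apply: (etrans (congr1 (@^~ h) (diffD (differentiableZ b (dw w)) (dw z)))).
  exact: (congr1 (fun v => v + diff2 Psi y h z) (congr1 (@^~ h) (diffZ b (dw w)))).
have E2 : 'd Psi y (b *: w + z) = b *: 'd Psi y w + 'd Psi y z by exact: linearP.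
have gen (j jw jz ew ez : 'rV[R]_d) : dot j (b *: jw + jz) - dot a (b *: ew + ez) =
    b * (dot j jw - dot a ew) + (dot j jz - dot a ez) by rewrite !dotE; ring.
apply: etrans (gen _ _ _ _ _).
exact: (congr2 (fun u v => dot ('d Psi y h) u - dot a v) E2 E1).
Qed.

(** On [c t = Psi (y + t h)] the function [|x - c t|^2 - k |c t - Psi y|^2] is minimal at 0, and
    half its second derivative there is the right side minus the left side. *)
Lemma second_form_growth {R : realType} {d : nat} (m : nat) (M U V : set 'rV[R]_d)
    Psi Phi (y x h : 'rV[R]_d) (k : R) : chart m M U V Psi Phi -> V y ->
  coord_plane m y -> coord_plane m h -> 0 <= k ->
  (forall eta, M eta -> enorm (x - Psi y) ^+ 2 + k * enorm (eta - Psi y) ^+ 2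
    <= enorm (x - eta) ^+ 2) ->
  k * enorm ('d Psi y h) ^+ 2 <= second_form Psi y (x - Psi y) h h.
Proof.
move=> ch Vy yE hE k0 growth; have nV := chart_nbhsV ch Vy.
have [_ _ _ [cPsi _] MP] := ch; have [dPsi dcPsi] := cPsi.
have dPsi2 z : V z -> differentiable (fun u => 'd Psi u h) z.
  by move=> Vz; have [dv _] := dcPsi h; exact: dv.
have Jx : dot (x - Psi y) ('d Psi y h) = 0.
  apply: (@nearest_orthogonal _ _ M); last exact: (tangent_chart_image ch).
  move=> eta Meta; rewrite -(@ler_pXn2r _ 2)// ?nnegrE ?enorm_ge0//.
  by rewrite (le_trans _ (growth _ Meta))// lerDl mulr_ge0// exprn_ge0// enorm_ge0.
pose c := fun t : R => Psi (y + t *: h).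
pose c' := fun t : R => 'd Psi (y + t *: h) h.
pose f := fun t : R => dot (x - c t) (x - c t) - k * dot (c t - Psi y) (c t - Psi y).
pose g := fun t : R => - (2 * dot (c' t) ((x - c t) + k *: (c t - Psi y))).
have y0 : y + (0 : R) *: h = y by rewrite scale0r addr0.
have nV0 : \forall t \near (0 : R), V (y + t *: h) by apply: near_line; rewrite y0.
have dc t : V (y + t *: h) -> is_derive t (1 : R) c (c' t).
  by move=> Vt; apply: is_derive_line; exact: dPsi.
have dxc t : V (y + t *: h) -> is_derive t (1 : R) (fun s => x - c s) (- c' t).
  by move=> /dc dct; have := is_deriveB (is_derive_cst x t 1) dct; rewrite sub0r.
have dcy t : V (y + t *: h) -> is_derive t (1 : R) (fun s => c s - Psi y) (c' t).
  by move=> /dc dct; have := is_deriveB dct (is_derive_cst (Psi y) t 1); rewrite subr0.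
have Vy0 : V (y + (0 : R) *: h) by rewrite y0.
have dc' : is_derive (0 : R) (1 : R) c' (diff2 Psi y h h).
  by have := is_derive_line (dPsi2 _ Vy0); rewrite y0.
have dz : is_derive (0 : R) (1 : R) (fun s => (x - c s) + k *: (c s - Psi y))
    (- c' 0 + k *: c' 0).
  exact: is_deriveD (dxc _ Vy0) (is_deriveZ k (dcy _ Vy0)).
have cE : c 0 = Psi y by rewrite /c y0.
have c'E : c' 0 = 'd Psi y h by rewrite /c' y0.
have dg := is_deriveN (is_deriveZ 2 (is_derive_dot dc' dz)).
have {dg} dg : is_derive (0 : R) (1 : R) g
   (- (2 * (dot (diff2 Psi y h h) (x - Psi y) +
     dot ('d Psi y h) (- 'd Psi y h + k *: 'd Psi y h)))).
  by apply: is_derive_eq dg _; rewrite c'E cE subrr scaler0 addr0.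
have : 0 <= - (2 * (dot (diff2 Psi y h h) (x - Psi y) +
    dot ('d Psi y h) (- 'd Psi y h + k *: 'd Psi y h))).
  apply: (min_second_derive _ _ dg).
  - apply: filterS nV0 => t Vt.
    have df := is_deriveB (is_derive_dot (dxc _ Vt) (dxc _ Vt))
      (is_deriveZ k (is_derive_dot (dcy _ Vt) (dcy _ Vt))).
    apply: is_derive_eq df _; rewrite /g.
    move: (c' t) (c t - Psi y) (x - c t) => a b e.
    rewrite -[k *: (_ + _)]/(k * (_ + _)) !dotE (dotC e a) (dotC b a).
    by move: (dot _ _) (dot _ _) => A B; ring.
  - by rewrite /g c'E cE subrr scaler0 addr0 dotC Jx mulr0 oppr0.
  apply: filterS nV0 => t Vt.
  have Mt : M (c t) := (MP _ Vt).2 (coord_planeD yE (coord_planeZ t hE)).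
  have := growth _ Mt; rewrite !sqr_enorm => gt.
  suff : f 0 <= f t by [].
  by rewrite /f cE subrr dot0l mulr0 subr0 lerBrDr.
have gen (D J a : 'rV[R]_d) : 0 <= - (2 * (dot D a + dot J (- J + k *: J))) ->
    k * enorm J ^+ 2 <= dot J J - dot a D.
  rewrite sqr_enorm !dotE (dotC a); move: (dot _ _) (dot _ _) => A B.
  by clear => *; lra.
exact: gen.
Qed.

Lemma second_form_eq0 {R : realType} {d : nat} (m : nat) (M U V : set 'rV[R]_d)
    Psi Phi (y x h : 'rV[R]_d) (k : R) : chart m M U V Psi Phi -> V y ->
  coord_plane m y -> coord_plane m h -> 0 < k ->
  (forall eta, M eta -> enorm (x - Psi y) ^+ 2 + k * enorm (eta - Psi y) ^+ 2
    <= enorm (x - eta) ^+ 2) ->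
  second_form Psi y (x - Psi y) h h = 0 -> h = 0.
Proof.
move=> ch Vy yE hE k0 growth q0.
have := second_form_growth ch Vy yE hE (ltW k0) growth; rewrite q0 => Jh.
apply: (chart_dPsi_inj ch Vy).
have gen (j : 'rV[R]_d) : k * enorm j ^+ 2 <= 0 -> j = 0.
  rewrite pmulr_rle0// sqr_enorm => j0.
  by apply/eqP; rewrite -dot_eq0 eq_le j0 dot_ge0.
exact: gen.
Qed.

(** * Differentiability of the nearest-point map *)

Lemma is_diff_fst {R : numFieldType} {V W : normedModType R} (z : V * W) :
  is_diff z (@fst V W) (@fst V W).
Proof.
have lf : linear (@fst V W) by [].
pose fL : {linear (V * W)%type -> V} := HB.pack (@fst V W) (GRing.isLinear.Build _ _ _ _ _ lf).
have cf : continuous fL by move=> u; exact: cvg_fst.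
by split; [exact: (@linear_differentiable _ _ _ fL)|exact: (@diff_lin _ _ _ fL)].
Qed.

Lemma is_diff_snd {R : numFieldType} {V W : normedModType R} (z : V * W) :
  is_diff z (@snd V W) (@snd V W).
Proof.
have lf : linear (@snd V W) by [].
pose fL : {linear (V * W)%type -> W} := HB.pack (@snd V W) (GRing.isLinear.Build _ _ _ _ _ lf).
have cf : continuous fL by move=> u; exact: cvg_snd.
by split; [exact: (@linear_differentiable _ _ _ fL)|exact: (@diff_lin _ _ _ fL)].
Qed.

(* The equations of the critical points: the coordinates of [normal_eq (x, y)]
   vanish iff [y] is in the plane and [x - Psi y] is normal to M at [Psi y]. *)
Definition normal_eq {R : realType} {d : nat} (m : nat) (Psi : 'rV[R]_d -> 'rV[R]_d)
    (z : 'rV[R]_d * 'rV[R]_d) : 'rV[R]_d :=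
  \row_(i < d) if (i < m)%N then dot (z.1 - Psi z.2) ('d Psi (z.2 : 'rV[R]_d) (delta_mx 0 i))
               else z.2 0 i.

Lemma diff_normal_eq {R : realType} {d : nat} (m : nat) (V : set 'rV[R]_d)
    (Psi : 'rV[R]_d -> 'rV[R]_d) (x y : 'rV[R]_d) : Ck 2 V Psi -> V y ->
  differentiable (normal_eq m Psi) (x, y) /\ forall k h (i : 'I_d),
    'd (normal_eq m Psi) (x, y) (k, h) 0 i =
    if (i < m)%N then dot k ('d Psi y (delta_mx 0 i)) -
      second_form Psi y (x - Psi y) h (delta_mx 0 i) else h 0 i.
Proof.
move=> [dPsi dcPsi] Vy.
have d2 w : differentiable (fun u => 'd Psi u w) y by have [dv _] := dcPsi w; exact: dv.
pose c (i : 'I_d) (z : 'rV[R]_d * 'rV[R]_d) : R :=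
  if (i < m)%N then dot (z.1 - Psi z.2) ('d Psi (z.2 : 'rV[R]_d) (delta_mx 0 i)) else z.2 0 i.
have dc i : is_diff (x, y) (c i) (fun v => if (i < m)%N
      then dot v.1 ('d Psi y (delta_mx 0 i)) -
      second_form Psi y (x - Psi y) v.2 (delta_mx 0 i) else v.2 0 i).
  rewrite /c; have [im|mi] := ltnP i m; last first.
    have [ds dsE] := is_diff_snd (x, y).
    have [dsi dsiE] := differentiable_coord_comp i ds.
    by split=> //; rewrite dsiE dsE.
  have dPs : is_diff (x, y) (Psi \o snd) ('d Psi y \o snd).
    by apply: is_diff_comp (is_diff_snd _) _; exact: differentiableP (dPsi _ Vy).
  have [dxP dxPE] : is_diff (x, y) (fun z => z.1 - Psi z.2) (fun v => v.1 - 'd Psi y v.2).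
    exact: is_diffB (is_diff_fst (x, y)) dPs.
  have [ddP ddPE] : is_diff (x, y) (fun z => 'd Psi (z.2 : 'rV[R]_d) (delta_mx 0 i))
      (fun v => diff2 Psi y v.2 (delta_mx 0 i)).
    exact: (is_diff_comp (is_diff_snd (x, y)) (differentiableP (d2 (delta_mx 0 i)))).
  have [dd ddE] := is_diff_dot dxP ddP.
  split=> //; rewrite ddE; apply/funext => v.
  have gen (k Jh J a D : 'rV[R]_d) :
      dot (k - Jh) J + dot a D = dot k J - (dot Jh J - dot a D) by rewrite dotBl; ring.
  apply: etrans (gen _ _ _ _ _).
  exact: (congr2 (fun s t => dot s ('d Psi y (delta_mx 0 i)) + dot (x - Psi y) t)
    (congr1 (@^~ v) dxPE) (congr1 (@^~ v) ddPE)).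
have dN : differentiable (normal_eq m Psi) (x, y).
  apply: differentiable_rV => i; have [dci _] := dc i.
  by have -> : (fun z => normal_eq m Psi z 0 i) = c i by apply/funext => z; rewrite mxE.
split=> // k h i; have [_ dNE] := differentiable_coord_comp i dN.
rewrite -(congr1 (@^~ (k, h)) dNE).
have -> : (fun z => normal_eq m Psi z 0 i) = c i by apply/funext => z; rewrite mxE.
by have [_ ->] := dc i.
Qed.

(** The chart expression [u] of the projection is differentiated implicitly, and the projection is
    [Psi \o u] near [x]. The last clause is the weak form of [(id - r L) Dp(x) v = P v], tested on
    tangent vectors; it also covers [x] in [M]. *)
Lemma closest_point_chart_diff {R : realType} {d : nat} (m : nat) (M U V : set 'rV[R]_d)
    Psi Phi (x : 'rV[R]_d) : chart m M U V Psi Phi -> unpp_int M x ->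
  U (closest_point M x) ->
  differentiable (closest_point M) x /\ forall v, exists h,
  [/\ coord_plane m h,
      'd (closest_point M) x v = 'd Psi (Phi (closest_point M x)) h &
      forall w, coord_plane m w -> dot v ('d Psi (Phi (closest_point M x)) w) =
        second_form Psi (Phi (closest_point M x)) (x - closest_point M x) h w].
Proof.
move=> ch xM Uxi; have uM := unpp_int_unpp xM.
have [Mxi _] := closest_pointP uM.
have [k k0 growth] := closest_point_quadratic_growth xM.
have [_ PsiK PhiK [cPsi cPhi] MP] := ch; have [Vy PsiPhi] := PhiK _ Uxi.
have cp := closest_point_cont xM.
pose u := Phi \o closest_point M.
set y := Phi (closest_point M x) in Vy PsiPhi *; set q := second_form Psi y (x - Psi y).
have yE : coord_plane m y := (chart_plane ch Uxi).1 Mxi.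
have q0 h : coord_plane m h -> q h h = 0 -> h = 0.
  move=> hE; apply: (second_form_eq0 ch Vy yE hE k0).
  by rewrite PsiPhi.
have qr h a w z : q h (a *: w + z) = a * q h w + q h z.
  exact: second_form_linearr cPsi Vy.
have ql w a h z : q (a *: h + z) w = a * q h w + q z w by exact: second_form_linearl.
have [Q Qu QE] := coercive_unitmx qr ql q0.
have [dN dNE] := diff_normal_eq m x cPsi Vy.
(* Linearising the equation gives [q h e_i = v.('d Psi y e_i)] for [i < m] and [h_i = 0] otherwise,
   that is, [h *m Q = b v]. *)
pose b (v : 'rV[R]_d) := \row_(i < d)
  if (i < m)%N then dot v ('d Psi y (delta_mx 0 i)) else 0.
have lb : linear (fun v => b v *m invmx Q).
  move=> a v w; rewrite scalemxAl -mulmxDl; congr (_ *m _); apply/rowP => i.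
  by rewrite !mxE; case: ifP => _; rewrite ?dotDl ?dotZl// mulr0 addr0.
pose S : {linear 'rV[R]_d -> 'rV[R]_d} :=
  HB.pack (fun v => b v *m invmx Q) (GRing.isLinear.Build _ _ _ _ _ lb).
have SQ v : S v *m Q = b v by rewrite mulmxKV.
have cu : {for x, continuous u}.
  apply: continuous_comp => //; apply: differentiable_continuous.
  by case: cPhi => dPhi _; exact: dPhi.
have nU : \forall z \near x, U (closest_point M z) by apply: cp; exact: chart_nbhsU ch Uxi.
have Nu : \forall z \near x, normal_eq m Psi (z, u z) = 0.
  near=> z.
  have zM : unpp M z by near: z; exact: xM.
  have Uz : U (closest_point M z) by near: z; exact: nU.
  have [Mz zmin] := closest_pointP zM; have [Vz Psiz] := PhiK _ Uz.
  have zE : coord_plane m (u z) := (chart_plane ch Uz).1 Mz.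
  apply/rowP => i; rewrite !mxE /=; have [im|mi] := ltnP i m; last exact: zE.
  rewrite /u /= Psiz; apply: (nearest_orthogonal zmin).
  rewrite -{1}Psiz; apply: (tangent_chart_image ch) => //.
  exact: coord_plane_delta.
have Nx : normal_eq m Psi (x, u x) = 0 := nbhs_singleton Nu.
have dS : is_diff x u S.
  (* Up to sign, ['d (normal_eq m Psi) (x, y) (0, h)] has the coordinates of [h *m Q]; hence the
     lower bound [s^-1], with [s] a Lipschitz constant of multiplication by the inverse of [Q]. *)
  have [s s0 Hs] := linear_lipschitz
    (@linear_rV_continuous _ _ _ (GRing.Linear.clone _ _ _ _ (mulmxr (invmx Q)) _)).
  apply: (@is_diff_implicit _ _ _ _ (normal_eq m Psi) u S x s^-1) => //.
  - by rewrite invr_gt0.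
  - exact: linear_rV_continuous.
  - by apply: filterS Nu => z ->; rewrite Nx.
  - move=> h; rewrite ler_pdivrMl//.
    have := Hs (h *m Q); rewrite /= mulmxK// => /le_trans; apply.
    rewrite ler_wpM2l ?(ltW s0)//; apply: ler_rV_norm => // i.
    rewrite QE; have := dNE 0 h i; case: ifP => im dE.
      by rewrite (le_trans _ (ler_coord _ 0 i))// dE dot0l sub0r normrN.
    by rewrite (le_trans _ (ler_coord _ 0 i))// dE.
  - move=> v; apply/rowP => i; rewrite dNE [RHS]mxE.
    have := QE (S v) i; rewrite SQ [in LHS]mxE; case: ifP => _ E.
      by apply/eqP; rewrite subr_eq0 E.
    by rewrite -E.
have [du duE] := dS.
have dPsi : differentiable Psi (u x) by case: cPsi => dPsi _; exact: dPsi.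
have PsiuE : \forall z \near x, (Psi \o u) z = closest_point M z.
  by apply: filterS nU => z /PhiK[].
have [dp dpE] := near_eq_is_diff PsiuE (differentiable_comp du dPsi).
split; first exact: dp.
move=> v; exists (S v); split.
- by move=> i mi; have := QE (S v) i; rewrite SQ [in LHS]mxE ltnNge mi.
- apply: (etrans (congr1 (@^~ v) dpE)).
  apply: (etrans (congr1 (@^~ v) (diff_comp du dPsi))).
  exact: (congr1 ('d Psi (u x)) (congr1 (@^~ v) duE)).
move=> w wE.
pose l (w : 'rV[R]_d) := dot v ('d Psi y w).
have lJ : linear l.
  by move=> a w1 w2; rewrite /l linearP dotDr dotZr.
pose lL : {linear 'rV[R]_d -> R} := HB.pack l (GRing.isLinear.Build _ _ _ _ _ lJ).
have lq : linear (q (S v)) by move=> a w1 w2; exact: qr.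
pose qL : {linear 'rV[R]_d -> R} := HB.pack (q (S v)) (GRing.isLinear.Build _ _ _ _ _ lq).
have -> : second_form Psi y (x - closest_point M x) (S v) w = qL w.
  by rewrite /qL /= /q PsiPhi.
apply: (coord_plane_linear_ext (f := lL) (g := qL) _ wE) => i im.
by have := QE (S v) i; rewrite SQ mxE im.
Unshelve. all: by end_near. Qed.

(** * Normal fields and the shape operator *)

Lemma cvg_rV {R : realType} {T : Type} {d : nat} (F : set_system T) (FF : Filter F)
    (f : T -> 'rV[R]_d) (l : 'rV[R]_d) :
  (forall i, f x 0 i @[x --> F] --> l 0 i) -> f @ F --> l.
Proof.
move=> fl; apply/cvgrPdist_le => e e0.
have : \forall x \near F, forall i, `|l 0 i - f x 0 i| <= e.
  by apply: filter_forall => i; move/cvgrPdist_le: (fl i); exact.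
apply: filterS => x fx; apply: ler_rV_norm => [|i]; first exact: ltW.
by rewrite !mxE.
Qed.

Lemma cvg_dot {R : realType} {T : topologicalType} {d : nat} (f g : T -> 'rV[R]_d) (x : T) :
  {for x, continuous f} -> {for x, continuous g} ->
  {for x, continuous (fun y => dot (f y) (g y))}.
Proof.
move=> cf cg; have [df _] := is_diff_fst (f x, g x); have [dg _] := is_diff_snd (f x, g x).
have [dfg _] := is_diff_dot df dg.
have cfg : (fun y => (f y, g y)) @ x --> (f x, g x).
  by apply: (@cvg_pair _ _ _ (nbhs x) (nbhs (f x)) (nbhs (g x)) _ _ _ f g); [exact: cf|exact: cg].
by move=> A /(differentiable_continuous dfg) /cfg.
Qed.

Lemma Ck1_of_diff {R : realType} {V W : normedModType R} (U : set V) (f : V -> W)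
    (f' : V -> V -> W) : open U -> (forall x, U x -> is_diff x f (f' x)) ->
  (forall w x, U x -> {for x, continuous (f' ^~ w)}) -> Ck 1 U f.
Proof.
move=> oU df cf'; split=> [x /df[]//|w x Ux].
apply: (near_eq_continuous _ (cf' w x Ux)).
apply: filterS (open_nbhs_nbhs (conj oU Ux)) => y /df[_].
exact: (@congr1 _ _ (@^~ w)).
Qed.

Lemma Ck1_rV {R : realType} {V : normedModType R} {d : nat} (U : set V)
    (f : V -> 'rV[R]_d) : open U -> (forall i, Ck 1 U (fun x => f x 0 i)) -> Ck 1 U f.
Proof.
move=> oU cf.
have df x : U x -> differentiable f x.
  by move=> Ux; apply: differentiable_rV => i; have [dfi _] := cf i; exact: dfi.
split=> // w x Ux; apply: cvg_rV => i; have [_ /(_ w x Ux) cfi] := cf i.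
apply: (near_eq_continuous _ cfi).
apply: filterS (open_nbhs_nbhs (conj oU Ux)) => y Uy.
by have [_ /(congr1 (@^~ w))] := differentiable_coord_comp i (df y Uy).
Qed.

Lemma Ck1_linear_comp {R : realType} {V W X : normedModType R} (U : set V)
    (f : V -> W) (L : {linear W -> X}) : open U -> continuous L -> Ck 1 U f ->
  Ck 1 U (L \o f).
Proof.
move=> oU cL [df cf]; apply: (@Ck1_of_diff _ _ _ _ _ (fun x w => L ('d f x w))) => //.
  move=> x Ux; have dL : is_diff (f x) L L.
    by split; [exact: linear_differentiable|exact: diff_lin].
  exact: is_diff_comp (differentiableP (df x Ux)) dL.
move=> w x Ux; apply: (@continuous_comp _ _ _ (fun y => 'd f y w) L); first exact: cf.
exact: cL.
Qed.

Lemma is_diff_scale {R : realType} {V : normedModType R} {d : nat}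
    (f : V -> R) (g : V -> 'rV[R]_d) (x : V) (f' : V -> R) (g' : V -> 'rV[R]_d) :
  is_diff x f f' -> is_diff x g g' ->
  is_diff x (fun y => f y *: g y) (fun w => f' w *: g x + f x *: g' w).
Proof.
move=> df [dg dgE].
have dfgi i : is_diff x (fun y => (f y *: g y) 0 i) (fun w => (f' w *: g x + f x *: g' w) 0 i).
  have -> : (fun y => (f y *: g y) 0 i) = f * (fun y => g y 0 i).
    by apply/funext => y; rewrite mxE.
  apply: is_diff_eq (is_diffM df (differentiable_coord_comp i dg)) _.
  apply/funext => w; rewrite !mxE -dgE addrC; congr (_ + _).
  by rewrite [RHS]mulrC.
have dfg : differentiable (fun y => f y *: g y) x.
  by apply: differentiable_rV => i; have [] := dfgi i.
split=> //; apply/funext => w; apply/rowP => i.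
have [_ E1] := differentiable_coord_comp i dfg; have [_ E2] := dfgi i.
exact: etrans (esym (congr1 (@^~ w) E1)) (congr1 (@^~ w) E2).
Qed.

Lemma Ck1_normalize {R : realType} {d n : nat} (U : set 'rV[R]_n)
    (N : 'rV[R]_n -> 'rV[R]_d) : open U -> Ck 1 U N -> (forall x, U x -> N x != 0) ->
  Ck 1 U (fun x => (enorm (N x))^-1 *: N x).
Proof.
move=> oU [dN cN] N0.
have D0 x : U x -> 0 < dot (N x) (N x).
  by move=> /N0 Nx; rewrite lt_neqAle dot_ge0 eq_sym dot_eq0 Nx.
(* The derivative of [t |-> 1 / sqrt t], as the chain rule yields it. *)
pose ds (t : R) := - (Num.sqrt t) ^- 2 * (2 * Num.sqrt t)^-1.
have dsP (t : R) : 0 < t -> is_diff t (fun t : R => (Num.sqrt t)^-1) (fun w => w * ds t).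
  move=> t0; have [/derivable1_diffP dq dqE] := is_derive1_sqrt t0.
  have qt0 : Num.sqrt t != 0 by rewrite sqrtr_eq0 -ltNge.
  split; first exact: differentiableV.
  apply/funext => w; apply: (etrans (congr1 (@^~ w) (diffV dq qt0))).
  have E : 'd Num.sqrt t w = w * (2 * Num.sqrt t)^-1.
    by rewrite -dqE (deriveE _ dq) -[w in LHS]mulr1 [LHS]linearZ.
  apply: (etrans (congr1 (fun z => - Num.sqrt t ^- 2 *: z) E)).
  by rewrite /ds [LHS]mulrCA.
pose n' x w := ((dot ('d N x w) (N x) + dot (N x) ('d N x w)) * ds (dot (N x) (N x))) *: N x
  + (enorm (N x))^-1 *: 'd N x w.
apply: (@Ck1_of_diff _ _ _ _ _ n' oU) => [x Ux|w x Ux].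
  apply: is_diff_scale (differentiableP (dN x Ux)).
  exact: is_diff_comp (is_diff_dot (dN x Ux) (dN x Ux)) (dsP _ (D0 x Ux)).
have cNx : {for x, continuous N} by apply: differentiable_continuous; exact: dN.
have cdN : {for x, continuous (fun y => 'd N y w)} by exact: cN.
have cD := cvg_dot cNx cNx.
have cq : {for x, continuous (fun y => Num.sqrt (dot (N y) (N y)))}.
  by apply: (@continuous_comp _ _ _ (fun y => dot (N y) (N y)) Num.sqrt) => //; exact: sqrt_continuous.
have q0 : Num.sqrt (dot (N x) (N x)) != 0 by rewrite sqrtr_eq0 -ltNge D0.
have cds : {for x, continuous (fun y => ds (dot (N y) (N y)))}.
  apply: (@cvgM _ _ (nbhs x)).
    apply: (@cvgN _ _ _ (nbhs x)); apply: (@cvgV _ _ (nbhs x)); first by rewrite expf_neq0.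
    by rewrite /= expr2; apply: (@cvgM _ _ (nbhs x)); exact: cq.
  apply: (@cvgV _ _ (nbhs x)); first by rewrite mulf_neq0.
  by apply: (@cvgMl_tmp _ _ (nbhs x)); exact: cq.
apply: (@cvgD _ _ _ (nbhs x)).
  apply: (@cvgZ _ _ _ (nbhs x)); last exact: cNx.
  apply: (@cvgM _ _ (nbhs x)); last exact: cds.
  apply: (@cvgD _ _ _ (nbhs x)); first exact: (cvg_dot cdN cNx).
  exact: (cvg_dot cNx cdN).
apply: (@cvgZ _ _ _ (nbhs x)); last exact: cdN.
by apply: (@cvgV _ _ (nbhs x)); [|exact: cq].
Qed.

(** Without such a field [shape_operator] would take its default value 0. The covector field built
    here is normalised on the open set where it does not vanish; it is C^1 because [Phi] is C^2. *)
Lemma unit_normal_field_exists {R : realType} {d : nat} (m : nat)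
    (M U V : set 'rV[R]_d) Psi Phi (xi v : 'rV[R]_d) :
  chart m M U V Psi Phi -> U xi -> M xi -> enorm v = 1 ->
  (forall w, tangent M xi w -> dot v w = 0) ->
  exists W n, unit_normal_field M W xi v n.
Proof.
move=> ch Uxi Mxi v1 vT.
have [[oU oV] PsiK PhiK [cPsi [dPhi cdPhi]] MP] := ch; have [Vy PsiPhi] := PhiK _ Uxi.
have yE := (chart_plane ch Uxi).1 Mxi.
(* [dot (N z)] is the covector [dot v \o 'd Psi (Phi xi)] pulled back by Phi: it
   is C^1 in z and kills the vectors tangent to M. *)
pose N (z : 'rV[R]_d) := \row_(j < d) dot v ('d Psi (Phi xi) ('d Phi z (delta_mx 0 j))).
have NE z w : dot (N z) w = dot v ('d Psi (Phi xi) ('d Phi z w)).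
  pose L : {linear 'rV[R]_d -> R} := dot v \o ('d Psi (Phi xi) \o 'd Phi z).
  have gen (l : {linear 'rV[R]_d -> R}) : dot (\row_j l (delta_mx 0 j)) w = l w.
    rewrite [in RHS](row_sum_delta w) linear_sum.
    by apply: eq_bigr => j _; rewrite linearZ !mxE mulrC.
  exact: (gen L).
have Nxi : N xi = v.
  apply/rowP => j; rewrite mxE -[RHS]dot_delta.
  by congr dot; exact: (chart_dPhiK _ ch Uxi).
have cN : Ck 1 U N.
  apply: Ck1_rV => // j.
  pose L : {linear 'rV[R]_d -> R} := dot v \o 'd Psi (Phi xi).
  have -> : (fun z => N z 0 j) = L \o (fun z => 'd Phi z (delta_mx 0 j)).
    by apply/funext => z; rewrite mxE.
  by apply: Ck1_linear_comp => //; exact: linear_rV_continuous.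
pose O := [set z | U z /\ N z != 0].
have oO : open O.
  rewrite openE => z [Uz Nz]; have [dN _] := cN.
  have := differentiable_continuous (dN z Uz) => /cvgr_neq0 /(_ Nz) nN.
  exact: filterI (chart_nbhsU ch Uz) nN.
have OU : O `<=` U by move=> z [].
have cNO : Ck 1 O N.
  by case: cN => dN cdN; split=> [z /OU|w z /OU]; [exact: dN|exact: cdN].
pose n z := (enorm (N z))^-1 *: N z.
have cn : Ck 1 O n by apply: Ck1_normalize => // z [].
have Oxi : O xi.
  split=> //; rewrite Nxi -enorm_eq0 v1 oner_eq0 //.
exists (M `&` O), n; split=> //.
- by exists O.
- by move=> z [Mz Oz]; exists O, n; split.
- move=> z [Mz [Uz Nz]]; split.
    by rewrite /n enormZ ger0_norm ?invr_ge0 ?enorm_ge0// mulVf// enorm_eq0.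
  move=> w /(tangent_chartP w ch Uz Mz) wE; rewrite /n dotZl NE.
  by rewrite vT ?mulr0// -{1}PsiPhi; exact: (tangent_chart_image ch).
- by rewrite /n Nxi v1 invr1 scale1r.
Qed.

Lemma curve_through_cont {R : realType} {d : nat} (M : set 'rV[R]_d)
    (xi w : 'rV[R]_d) (c : R -> 'rV[R]_d) : curve_through M xi w c ->
  c @ (0 : R) --> xi /\ \forall t \near (0 : R), M (c t).
Proof.
move=> [[e e0 [[dc _] cM]] c0 _].
have e00 : `]-e, e[%classic (0 : R) by rewrite /= in_itv /= oppr_lt0 e0.
split; first by rewrite -c0; apply: differentiable_continuous; exact: dc.
have nI : nbhs (0 : R) `]-e, e[%classic.
  by apply: open_nbhs_nbhs; split=> //; exact: interval_open.
by apply: filterS nI => t; exact: cM.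
Qed.

(** By the chain rule for the extension [F], every curve with velocity [w] gives the same value, so
    the choice in [deriv_along] is determined. *)
Lemma deriv_alongE {R : realType} {d : nat} (M : set 'rV[R]_d)
    (n F : 'rV[R]_d -> 'rV[R]_d) (xi w : 'rV[R]_d) : differentiable F xi ->
  (\forall eta \near xi, M eta -> F eta = n eta) -> tangent M xi w ->
  deriv_along M n xi w = 'd F xi w.
Proof.
move=> dF Fn wT.
have dnc c : curve_through M xi w c -> is_derive (0 : R) (1 : R) (n \o c) ('d F xi w).
  move=> cw; have [cxi cM] := curve_through_cont cw; case: cw => _ c0 [dc <-].
  have /derivable1_diffP {}dc := dc.
  have dFc : differentiable F (c 0) by rewrite c0.
  have [dFoc dFocE] := is_diff_comp (differentiableP dc) (differentiableP dFc).
  have FnE : \forall t \near (0 : R), (F \o c) t = (n \o c) t.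
    near=> t; have Mt : M (c t) by near: t; exact: cM.
    by move: Mt; near: t; exact: (cxi _ Fn).
  apply: near_eq_is_derive FnE _; split; first exact: diff_derivable.
  rewrite (deriveE _ dFoc) (deriveE _ dc) -c0.
  exact: (congr1 (@^~ 1) dFocE).
rewrite /deriv_along; case: xgetP => [u _ [c [cw [_ <-]]]|].
  by have [_ ->] := dnc _ cw.
have [c cw] := wT; move=> /(_ ('d F xi w)) []; exists c; split=> //.
exact: dnc.
Unshelve. all: by end_near. Qed.

(** Weingarten's equation: [F (Psi z)] is orthogonal to ['d Psi z w] for all [z] in the plane near
    [y], and this identity is differentiated in the direction [h] of the plane. *)
Lemma diff_normal_field {R : realType} {d : nat} (m : nat) (M U V : set 'rV[R]_d)
    Psi Phi (F : 'rV[R]_d -> 'rV[R]_d) (y h w : 'rV[R]_d) :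
  chart m M U V Psi Phi -> V y -> coord_plane m y -> coord_plane m h ->
  coord_plane m w -> differentiable F (Psi y) ->
  (\forall eta \near Psi y, M eta -> forall z, tangent M eta z -> dot (F eta) z = 0) ->
  dot ('d F (Psi y) ('d Psi y h)) ('d Psi y w) + dot (F (Psi y)) (diff2 Psi y h w) = 0.
Proof.
move=> ch Vy yE hE wE dF nF; have nV := chart_nbhsV ch Vy.
have [_ _ _ [[dPsi dcPsi] _] MP] := ch.
have dw : differentiable (fun u => 'd Psi u w) y by have [dv _] := dcPsi w; exact: dv.
have dPy := dPsi _ Vy; have [dFP dFPE] := is_diff_comp (differentiableP dPy) (differentiableP dF).
have [df dfE] := is_diff_dot dFP dw.
have f0 : \forall z \near y, coord_plane m z -> dot ((F \o Psi) z) ('d Psi z w) = 0.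
  apply: filterS2 nV (differentiable_continuous dPy nF) => z Vz Hz zE.
  by apply: Hz; [apply/MP|exact: (tangent_chart_image ch)].
have fy := nbhs_singleton f0 yE.
have fl : \forall t \near (0 : R), coord_plane m (y + t *: h) ->
    dot ((F \o Psi) (y + t *: h)) ('d Psi (y + t *: h) w) = 0.
  by apply: (@near_line _ _ (fun z => coord_plane m z -> dot ((F \o Psi) z) ('d Psi z w) = 0));
    rewrite scale0r addr0.
have d0 : 'd (fun z => dot ((F \o Psi) z) ('d Psi z w)) y h = 0 :> R.
  apply: diff_eq_along => //; apply: filterS fl => t H.
  by rewrite fy; exact: H (coord_planeD yE (coord_planeZ t hE)).
have E1 := congr1 (@^~ h) dfE; have E2 := congr1 (@^~ h) dFPE.
rewrite -d0; apply: (etrans _ (esym E1)).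
exact: (congr1 (fun s => dot s ('d Psi y w) + dot (F (Psi y)) (diff2 Psi y h w))
  (esym E2)).
Qed.

Lemma tangent_chart_range {R : realType} {d : nat} (m : nat) (M U V : set 'rV[R]_d)
    Psi Phi xi : chart m M U V Psi Phi -> U xi -> M xi ->
  tangent M xi = [set 'd Psi (Phi xi) h | h in coord_plane m].
Proof.
move=> ch Uxi Mxi; have [_ _ PhiK _ _] := ch; have [Vy PsiPhi] := PhiK _ Uxi.
have yE := (chart_plane ch Uxi).1 Mxi.
apply/seteqP; split=> [w /(tangent_chartP w ch Uxi Mxi) wE|_ [h hE <-]].
  by exists ('d Phi xi w); [exact: wE|exact: (chart_dPhiK w ch Uxi)].
by rewrite -{1}PsiPhi; exact: (tangent_chart_image ch).
Qed.

(** [A] represents [q] on [T]. Definiteness gives injectivity; for surjectivity, solving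
    [q h w = z.(J w)] leaves a residual [A (J h) - z] that lies in [T] and is orthogonal to [T]. *)
Lemma form_operator_bij {R : realType} {d : nat} (m : nat)
    (J : {linear 'rV[R]_d -> 'rV[R]_d}) (T : set 'rV[R]_d)
    (q : 'rV[R]_d -> 'rV[R]_d -> R) (A : 'rV[R]_d -> 'rV[R]_d) :
  T = [set J h | h in coord_plane m] ->
  (forall h a w z, q h (a *: w + z) = a * q h w + q h z) ->
  (forall w a h k, q (a *: h + k) w = a * q h w + q k w) ->
  (forall h, coord_plane m h -> q h h = 0 -> h = 0) ->
  (forall z, T z -> T (A z)) ->
  (forall h w, coord_plane m h -> coord_plane m w -> dot (A (J h)) (J w) = q h w) ->
  set_bij T T A.
Proof.
move=> TE qr ql q0 AT Aq; split=> //.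
  move=> z1 z2; rewrite !inE TE => -[h1 h1E <-] [h2 h2E <-] A12.
  suff -> : h1 = h2 by [].
  apply/eqP; rewrite -subr_eq0; apply/eqP; apply: q0; first exact: coord_planeB.
  have hE : coord_plane m (h1 - h2) by exact: coord_planeB.
  by rewrite addrC -scaleN1r ql -!Aq ?A12 ?mulN1r ?addNr// addrC scaleN1r.
move=> z Tz; have [h hE hz] : exists2 h, coord_plane m h &
    forall w, coord_plane m w -> q h w = dot z (J w).
  pose l : {linear 'rV[R]_d -> R} := dot z \o J.
  exact: (coercive_solve l qr ql q0).
have TJ : T (J h) by rewrite TE; exists h.
exists (J h) => //; apply/eqP; rewrite -subr_eq0 -dot_eq0.
have [k kE kz] : exists2 k, coord_plane m k & J k = A (J h) - z.
  have := AT _ TJ; rewrite TE => -[k1 k1E <-]; move: Tz; rewrite TE => -[k2 k2E <-].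
  by exists (k1 - k2); [exact: coord_planeB|exact: raddfB].
by rewrite -{2}kz dotBl Aq// hz// subrr.
Qed.

(** The shape operator represents the second fundamental form. Whichever normal field is chosen,
    Weingarten's equation fixes the products with tangent vectors, and the projection leaves these
    products unchanged. *)
Lemma shape_operator_form {R : realType} {d : nat} (m : nat) (M U V : set 'rV[R]_d)
    Psi Phi (xi v h : 'rV[R]_d) : chart m M U V Psi Phi -> U xi -> M xi ->
  enorm v = 1 -> (forall w, tangent M xi w -> dot v w = 0) -> coord_plane m h ->
  tangent M xi (shape_operator M xi v ('d Psi (Phi xi) h)) /\
  forall w, coord_plane m w ->
    dot (shape_operator M xi v ('d Psi (Phi xi) h)) ('d Psi (Phi xi) w) =
    dot v (diff2 Psi (Phi xi) h w).
Proof.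
move=> ch Uxi Mxi v1 vT hE.
have [_ _ PhiK _ _] := ch; have [Vy PsiPhi] := PhiK _ Uxi.
have yE := (chart_plane ch Uxi).1 Mxi.
have TE := tangent_chart_range ch Uxi Mxi.
have TJ w : coord_plane m w -> tangent M xi ('d Psi (Phi xi) w).
  by move=> wE; rewrite TE; exists w.
have PT z := (orthoprojP z (orthoproj (tangent M xi) z)
  (fun h _ => chart_dPsi_inj (h := h) ch Vy) TE).2 erefl.
rewrite /shape_operator; case: xgetP => [L _ [W [n [nW ->]]]|]; last first.
  have [W [n nW]] := unit_normal_field_exists ch Uxi Mxi v1 vT.
  by move=> /(_ (fun w => - orthoproj (tangent M xi) (deriv_along M n xi w))) [];
    exists W, n.
have [[B oB WE] Wxi nC1 nunit nxi] := nW.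
have [C [F [oC Cxi [dF _] Fn]]] := nC1 _ Wxi.
have {}dF : differentiable F xi by exact: dF.
have Bxi : B xi by move: Wxi; rewrite WE => -[].
have nF : \forall eta \near xi, M eta -> W eta /\ F eta = n eta.
  apply: filterS (filterI (open_nbhs_nbhs (conj oC Cxi)) (open_nbhs_nbhs (conj oB Bxi))).
  move=> eta [Ceta Beta] Meta; have Weta : W eta by rewrite WE.
  by split=> //; exact: Fn.
have nFn : \forall eta \near xi, M eta -> F eta = n eta.
  by apply: filterS nF => eta H /H[].
rewrite (deriv_alongE dF nFn (TJ h hE)).
have [PT1 PT2] := PT ('d F xi ('d Psi (Phi xi) h)).
split.
  move: PT1; rewrite TE => -[k kE <-]; exists (- k); last exact: raddfN.
  by rewrite -scaleN1r; exact: coord_planeZ.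
move=> w wE; have := PT2 _ (TJ w wE).
have nFT : \forall eta \near Psi (Phi xi), M eta -> forall z, tangent M eta z ->
    dot (F eta) z = 0.
  rewrite PsiPhi; apply: filterS nF => eta H Meta z zT; have [Weta ->] := H Meta.
  by have [_ ->] := nunit _ Weta.
have dFP : differentiable F (Psi (Phi xi)) by rewrite PsiPhi.
have := diff_normal_field ch Vy yE hE wE dFP nFT.
have Fxi : F xi = v by rewrite -nxi (nbhs_singleton nFn).
rewrite PsiPhi Fxi.
move: (dot v _) (orthoproj _ _) => a b; rewrite dotBl dotNl.
by move: (dot _ _) (dot _ _) => s t; clear; lra.
Qed.

(** Bijectivity of [A] on [T] is part of the conclusion, so that ['pinv_] is a true inverse at the
    values of [orthoproj T]. *)
Theorem theorem3 (R : realType) (d m : nat) (m_lt_d : (m < d)%N)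
    (M : set 'rV[R]_d) (M_C2 : submanifold 2 m M) :
  (forall x : 'rV[R]_d, unpp_int M x -> ~ M x ->
     let xi := closest_point M x in
     let T := tangent M xi in
     let r := enorm (x - xi) in
     let v := r^-1 *: (x - xi) in
     let A := fun w : 'rV[R]_d => w - r *: shape_operator M xi v w in
     [/\ set_bij T T A,
         differentiable (closest_point M) x &
         'd (closest_point M) x = 'pinv_(fun=> 0) T A \o orthoproj T
           :> ('rV[R]_d -> 'rV[R]_d)]) /\
  (forall x : 'rV[R]_d, M x ->
     [/\ unpp_int M x,
         differentiable (closest_point M) x &
         'd (closest_point M) x = orthoproj (tangent M (closest_point M x))
           :> ('rV[R]_d -> 'rV[R]_d)]).
Proof.
split=> [x xM nMx xi T r v A|x Mx]; last first.
  have xM := submanifold_sub_unpp_int M_C2 Mx.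
  have px := closest_point_id (unpp_int_unpp xM) Mx.
  have [U [V [Psi [Phi [ch Ux]]]]] := submanifold_chart M_C2 Mx.
  have [|dp dpE] := closest_point_chart_diff ch xM; first by rewrite px.
  rewrite px in dpE *; split; [exact: xM|exact: dp|apply/funext => k].
  have [h [hE hk kh]] := dpE k; apply: (etrans hk).
  have [_ _ PhiK _ _] := ch; have [Vy _] := PhiK _ Ux.
  have TE := tangent_chart_range ch Ux Mx.
  (* As [x - p(x) = 0], [second_form] is the Gram form of ['d Psi], and the weak equation says that
     [k - Dp(x) k] is orthogonal to the tangent space. *)
  apply/(orthoprojP _ _ (fun h _ => chart_dPsi_inj (h := h) ch Vy) TE); split.
    by rewrite TE; exists h.
  move=> z; rewrite TE => -[w wE <-]; rewrite dotBl kh// /second_form subrr dot0l subr0.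
  exact: subrr.
have uM := unpp_int_unpp xM; have [Mxi xi_min] := closest_pointP uM.
have [U [V [Psi [Phi [ch Uxi]]]]] := submanifold_chart M_C2 Mxi.
have [k k0 growth] := closest_point_quadratic_growth xM.
have [dp dpE] := closest_point_chart_diff ch xM Uxi.
have TE := tangent_chart_range ch Uxi Mxi.
rewrite -/xi in Mxi xi_min Uxi growth dpE TE; rewrite -/T in TE.
have [_ _ PhiK [cPsi _] _] := ch; have [Vy PsiPhi] := PhiK _ Uxi.
have yE := (chart_plane ch Uxi).1 Mxi.
have r0 : r != 0.
  by rewrite enorm_eq0 subr_eq0; apply/eqP => xxi; apply: nMx; rewrite xxi.
have v1 : enorm v = 1.
  by rewrite enormZ ger0_norm ?invr_ge0 ?enorm_ge0// mulVf.
have vT w : tangent M xi w -> dot v w = 0.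
  by move=> wT; rewrite dotZl (nearest_orthogonal xi_min wT) mulr0.
have shape h := shape_operator_form (h := h) ch Uxi Mxi v1 vT.
have AT z : T z -> T (A z).
  rewrite {1}TE => -[h hE <-]; have [] := shape h hE; rewrite -/T TE => -[h' h'E h'S] _.
  exists (h - r *: h'); first by apply: coord_planeB => //; exact: coord_planeZ.
  by rewrite /A -h'S linearB linearZ.
(* Here [r v = x - xi] turns the second fundamental form in direction [v] into the term of
   [second_form]. *)
have Aq h w : coord_plane m h -> coord_plane m w ->
    dot (A ('d Psi (Phi xi) h)) ('d Psi (Phi xi) w) = second_form Psi (Phi xi) (x - xi) h w.
  move=> hE wE; have [_ /(_ w wE) Sw] := shape h hE.
  by rewrite /A dotBl dotZl Sw /v dotZl mulrA divff// mul1r.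
have q0 h : coord_plane m h -> second_form Psi (Phi xi) (x - xi) h h = 0 -> h = 0.
  move=> hE; have := second_form_eq0 (x := x) ch Vy yE hE k0.
  by rewrite PsiPhi; exact.
have bijA : set_bij T T A.
  apply: (form_operator_bij TE _ _ q0 AT Aq) => [h a w z|w a h z].
    exact: second_form_linearr cPsi Vy.
  exact: second_form_linearl.
split; [exact: bijA|exact: dp|apply/funext => z].
have [h [hE hz zh]] := dpE z; apply: (etrans hz).
have TJ : T ('d Psi (Phi xi) h) by rewrite TE; exists h.
(* The weak equation makes [z - A (Dp(x) z)] orthogonal to [T]; inverting [A] then gives the
   formula. *)
have AJ : A ('d Psi (Phi xi) h) = orthoproj T z.
  apply/(orthoprojP _ _ (fun h _ => chart_dPsi_inj (h := h) ch Vy) TE); split; first exact: AT.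
  by move=> _ /[1!TE] -[w wE <-]; rewrite dotBl zh// Aq// subrr.
rewrite /= -AJ pinvKV//; last by rewrite inE.
by case: bijA => _ + _; exact.
Qed.
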